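(* Let $n,m$ be positive integers, let $0<\alpha<1$, let $X:\mathbb{R}^n\to\mathbb{R}^m$ be index-$\alpha$ fractional Brownian motion and let $E\subset\mathbb{R}^n$ be a non-empty compact set. Then, almost surely, $$\underline{\dim}_{\rm B}X(E)=\frac1\alpha\,\underline{\dim}_{\rm B}^{\,m\alpha}E\quad\text{and}\quad \overline{\dim}_{\rm B}X(E)=\frac1\alpha\,\overline{\dim}_{\rm B}^{\,m\alpha}E .$$
   Context: Index-$\alpha$ fractional Brownian motion $(0<\alpha<1)$ is the Gaussian random function $X=(X_1,\ldots,X_m):\mathbb{R}^n\to\mathbb{R}^m$ that with probability $1$ is continuous with $X(0)=0$, whose coordinates $X_i:\mathbb{R}^n\to\mathbb{R}$ are independent, and such that each increment $X_i(x)-X_i(y)$ is normal with mean $0$ and variance $|x-y|^{2\alpha}$, i.e. for Borel $A\subset\mathbb{R}$ and $x\neq y$ $$\mathbb{P}\big(X_i(x)-X_i(y)\in A\big)=\frac{1}{\sqrt{2\pi}}\frac{1}{|x-y|^\alpha}\int_{t\in A}\exp\Big(\frac{-t^2}{2|x-y|^{2\alpha}}\Big)dt .$$ For $s>0$ and $r>0$ let $\phi_r^s(x)=\min\{1,(r/|x|)^s\}$ for $x\in\mathbb{R}^n$ (with $\phi_r^s(0)=1$). For non-empty compact $E\subset\mathbb{R}^n$ let $\mathcal{M}(E)$ be the set of Borel probability measures supported by $E$. The capacity $C_r^s(E)$ is defined by $$\frac{1}{C_r^s(E)}=\inf_{\mu\in\mathcal{M}(E)}\int\int\phi_r^s(x-y)\,d\mu(x)\,d\mu(y).$$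 The lower and upper $s$-box dimension profiles of $E$ are $$\underline{\dim}_{\rm B}^{\,s}E=\liminf_{r\to0}\frac{\log C_r^s(E)}{-\log r},\qquad \overline{\dim}_{\rm B}^{\,s}E=\limsup_{r\to0}\frac{\log C_r^s(E)}{-\log r}.$$ For a non-empty compact set $A$ in a Euclidean space let $N_r(A)$ be the minimum number of sets of diameter $r$ that can cover $A$. The lower and upper box-counting dimensions of $A$ are $$\underline{\dim}_{\rm B}A=\liminf_{r\to0}\frac{\log N_r(A)}{-\log r},\qquad \overline{\dim}_{\rm B}A=\limsup_{r\to0}\frac{\log N_r(A)}{-\log r}.$$ *)

(* Defs.v *)
From HB Require Import structures.
From mathcomp Require Import all_boot all_order all_algebra.
From mathcomp Require Import all_classical all_reals all_analysis.

Set Implicit Arguments.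
Unset Strict Implicit.
Unset Printing Implicit Defensive.

Import Order.TTheory GRing.Theory Num.Theory.
Import numFieldNormedType.Exports.

Local Open Scope classical_set_scope.
Local Open Scope ring_scope.

(* R^n is 'rV[R]_n; its library norm is the sup norm, hence the explicit
   Euclidean norm. Both induce the library topology used for [continuous],
   [compact] and [open]. *)
Definition enorm (R : realType) (n : nat) (x : 'rV[R]_n) : R :=
  Num.sqrt (\sum_(i < n) x ord0 i ^+ 2).

Notation borel_rV R n := (g_sigma_algebraType (@open 'rV[R]_n)).

Section dimensions.
Local Open Scope ereal_scope.
Variables (R : realType) (n : nat).
Implicit Types (r s : R) (E A : set 'rV[R]_n).

Definition kernel_phi r s (x : 'rV[R]_n) : R :=
  if x == 0%R then 1%R else Num.min 1%R ((r / enorm x) `^ s)%R.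

Definition supported_by E (mu : probability (borel_rV R n) R) : Prop :=
  mu (~` E) = 0.

Definition energy r s (mu : probability (borel_rV R n) R) : \bar R :=
  \int[mu]_x \int[mu]_y (kernel_phi r s ((x : 'rV[R]_n) - y)%R)%:E.

(* For E nonempty compact the infimum is in ]0, 1], so the capacity is a real
   number >= 1. *)
Definition capacity r s E : \bar R :=
  (ereal_inf [set energy r s mu | mu in supported_by E])^-1.

Definition lower_box_profile s E : \bar R :=
  limf_einf (fun r => lne (capacity r s E) / (- ln r)%:E) 0%R^'+.

Definition upper_box_profile s E : \bar R :=
  limf_esup (fun r => lne (capacity r s E) / (- ln r)%:E) 0%R^'+.

Definition diameter A : \bar R :=
  ereal_sup [set (enorm (z.1 - z.2)%R)%:E | z in A `*` A].

Definition coverable r A (k : nat) : Prop :=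
  exists U : 'I_k -> set 'rV[R]_n,
    (forall i, diameter (U i) = r%:E) /\ A `<=` \bigcup_i U i.

(* The default value 0 is irrelevant: when n, r > 0 and A is nonempty and
   bounded, such a k exists, is unique and is positive. *)
Definition covering_number r A : nat :=
  xget 0%N [set k | coverable r A k /\
                    forall j, coverable r A j -> (k <= j)%N].

Definition lower_box_dim A : \bar R :=
  limf_einf (fun r => (ln (covering_number r A)%:R / (- ln r))%:E) 0%R^'+.

Definition upper_box_dim A : \bar R :=
  limf_esup (fun r => (ln (covering_number r A)%:R / (- ln r))%:E) 0%R^'+.

End dimensions.

Section fractional_brownian_motion.
Context d (T : measurableType d) (R : realType) (P : probability T R).

(* The degenerate case is treated apart because [normal_prob m 0] is the
   uniform distribution on [0, 1]. *)
Definition normally_distributed (Y : T -> R) : Prop :=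
  exists m s : R, forall A : set R, measurable A ->
    P (Y @^-1` A) = if s == 0 then \d_m A else normal_prob m s A.

Variables (n m : nat) (X : T -> 'rV[R]_n -> 'rV[R]_m).

Definition coord (i : 'I_m) (x : 'rV[R]_n) : T -> R :=
  fun w => X w x ord0 i.

(* All finite-dimensional distributions are (possibly degenerate) multivariate
   normal. *)
Definition gaussian_function : Prop :=
  forall (k : nat) (c : 'I_k -> R) (i : 'I_k -> 'I_m) (x : 'I_k -> 'rV[R]_n),
    normally_distributed (fun w => \sum_(j < k) c j * coord (i j) (x j) w).

Definition coord_sigma_algebra (i : 'I_m) : set (set T) :=
  <<s [set S | exists (x : 'rV[R]_n) (B : set R),
                 measurable B /\ S = coord i x @^-1` B] >>.

Definition independent_coords : Prop :=
  forall (J : {set 'I_m}) (S : 'I_m -> set T),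
    (forall i, i \in J -> coord_sigma_algebra i (S i)) ->
    P (\bigcap_(i in [set` J]) S i) = (\prod_(i in J) P (S i))%E.

Record fractional_brownian_motion (alpha : R) : Prop := {
  fbm_measurable : forall i x, measurable_fun [set: T] (coord i x);
  fbm_continuous : {ae P, forall w, continuous (X w) /\ X w 0 = 0};
  fbm_gaussian : gaussian_function;
  fbm_independent : independent_coords;
  fbm_increment : forall (i : 'I_m) (x y : 'rV[R]_n), x != y ->
    forall A : set R, measurable A ->
      P ((fun w => coord i x w - coord i y w) @^-1` A) =
      normal_prob 0 (enorm (x - y) `^ alpha) A
}.

End fractional_brownian_motion.

(* Main.v *)
Require Import Defs.
From mathcomp Require Import all_boot all_order all_algebra.
From mathcomp Require Import all_classical all_reals all_analysis.
From mathcomp Require Import measurable_realfun.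
From mathcomp Require Import ring lra.

(** Both identities follow from one almost sure comparison. Write [rho] for
    [r `^ alpha^-1] and [C rho] for the capacity of [E] at scale [rho] and
    exponent [m * alpha]. Almost surely, for every [eps > 0] there is a
    constant [L] such that for all small [r] the covering number of the image
    of [E] at scale [r] lies between [L^-1 * C rho * r^eps] and
    [L * C rho * r^-eps]. Dividing logarithms by [- ln r = - alpha * ln rho]
    turns this into the two equalities, because the change of variable
    [r |-> r `^ alpha^-1] preserves upper and lower limits at [0] on the right
    ([limf_esup_powR], [limf_einf_powR], [ln_ratio_near]).

    The capacity is first reduced to finite sums. A finitely supported
    probability measure on [E] is admissible in the infimum, and conversely any
    measure carried by [E] can be collapsed onto one point per cell of a grid
    of mesh [r]: this changes the energy at scale [r] by a bounded factor only,
    since the kernel does not vary much when its arguments move by [r]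
    ([capacity_finite_energy]).

    Lower bound for the covering number. The [m] independent Gaussian
    increments between [x] and [y] are all bounded by [r] with probability at most
    [phi (m * alpha) rho (x - y)] ([close_images_prob]). So, for weights [p] of
    nearly minimal energy [e] on points [x i] of [E], the expected [p]-mass of
    the pairs of points whose images are [r]-close is at most [e]. If [k] sets
    of diameter [r] cover the image, the Cauchy-Schwarz inequality bounds that
    mass below by [1 / k]. Markov's inequality and the Borel-Cantelli lemma
    along the scales [2^-k] conclude ([ae_cap_le_covering]).

    Upper bound for the covering number. By Kolmogorov's chaining argument the
    paths are almost surely [beta]-Hoelder on [E] for every [beta < alpha]
    ([ae_increment_bound]). Fix such a path and choose one point of [E] for
    each of the [M] cubes of a grid of diameter [r] that the image meets. The
    energy of the uniform measure on these points is at least [1 / C rho]; it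
    is also at most [1 / M], up to a power of [r] of small exponent and a power
    of [ln r], because the kernel at two chosen points is controlled by the
    distance between their cubes and the sum over all cubes of the product over
    the coordinates of the inverse distances is a power of a harmonic sum
    ([card_image_cells_le]). Hence [M] exceeds [C rho] by a negligible factor
    at most ([covering_number_le_cap]). *)

Set Implicit Arguments.
Unset Strict Implicit.
Unset Printing Implicit Defensive.

Import Order.TTheory GRing.Theory Num.Theory.
Import numFieldNormedType.Exports.

Local Open Scope classical_set_scope.
Local Open Scope ring_scope.

(** * Upper and lower limits at zero *)

Lemma near_eq_limf_esup (R : realType) (f g : R -> \bar R)
    (F : set_system R) :
  Filter F -> (\forall r \near F, f r = g r) -> limf_esup f F = limf_esup g F.
Proof.
move=> FF; wlog suff le : f g / (\forall r \near F, f r = g r) ->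
    (limf_esup f F <= limf_esup g F)%E.
  move=> fg; apply/eqP; rewrite eq_le !le//.
  by apply: filterS fg => r ->.
move=> fg; rewrite !limf_esupE.
apply: le_ereal_inf_tmp => _ [V FV <-].
apply: (@le_trans _ _
  (ereal_sup (f @` (V `&` [set r | f r = g r])))).
  apply: ereal_inf_lbound; exists (V `&` [set r | f r = g r]) => //.
  exact: filterI.
apply: ge_ereal_sup => _ [r [Vr /= ->] <-].
by apply: ereal_sup_ubound; exists r.
Qed.

Lemma near_eq_limf_einf (R : realType) (f g : R -> \bar R)
    (F : set_system R) :
  Filter F -> (\forall r \near F, f r = g r) -> limf_einf f F = limf_einf g F.
Proof.
move=> FF fg; rewrite /limf_einf; congr (- _)%E.
by apply: near_eq_limf_esup; apply: filterS fg => r ->.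
Qed.

(** The map [r |-> r `^ a] sends small positive reals to small positive reals. *)
Lemma near_powR_at_right0 (R : realType) (a : R) (V : set R) : 0 < a ->
  (\forall r \near 0^'+, V r) -> \forall r \near 0^'+, V (r `^ a).
Proof.
move=> a0 [e /= e0 eV].
exists (e `^ a^-1) => /=; first by rewrite powR_gt0.
move=> r /=; rewrite sub0r normrN => re r0.
apply: eV => /=; last by rewrite powR_gt0.
rewrite sub0r normrN gtr0_norm ?powR_gt0//.
rewrite gtr0_norm// in re.
have := gt0_ltr_powR a0 (ltW r0) (powR_ge0 _ _) re.
by rewrite -powRrM mulVf ?gt_eqF// powRr1// ltW.
Qed.

(** Half of the change of variable [r |-> r `^ a] in an upper limit. As the
    inverse of that map has the same form, applying it twice yields an
    equality. *)
Lemma le_limf_esup_powR (R : realType) (a : R) (u v : R -> R) : 0 < a ->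
  (forall eps : R, 0 < eps ->
     \forall r \near 0^'+, u r <= a * v (r `^ a) + eps) ->
  (limf_esup (EFin \o u) 0^'+ <= a%:E * limf_esup (EFin \o v) 0^'+)%E.
Proof.
move=> a0 uv; rewrite -lee_pdivrMl// [in leRHS]limf_esupE.
apply: le_ereal_inf_tmp => _ [V FV <-].
rewrite lee_pdivrMl//.
apply/lee_addgt0Pr => eps eps0; rewrite limf_esupE.
pose W := [set r | V (r `^ a) /\ u r <= a * v (r `^ a) + eps].
apply: (@le_trans _ _ (ereal_sup ((EFin \o u) @` W))).
  apply: ereal_inf_lbound; exists W => //.
  by apply: filterI; [exact: near_powR_at_right0|exact: uv].
apply: ge_ereal_sup => _ [r [/= Vr ur] <-].
apply: (@le_trans _ _ (a * v (r `^ a) + eps)%:E); first by rewrite lee_fin.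
rewrite EFinD leeD2r// EFinM lee_pmul2l ?fin_numE// ?lte_fin//.
by apply: ereal_sup_ubound; exists (r `^ a).
Qed.

Lemma limf_esup_powR (R : realType) (a : R) (u v : R -> R) : 0 < a ->
  (forall eps : R, 0 < eps ->
     \forall r \near 0^'+, `|u r - a * v (r `^ a)| <= eps) ->
  limf_esup (EFin \o u) 0^'+ = (a%:E * limf_esup (EFin \o v) 0^'+)%E.
Proof.
move=> a0 uv; apply/eqP; rewrite eq_le; apply/andP; split.
  apply: le_limf_esup_powR => // eps /uv; apply: filterS => r.
  by rewrite ler_norml lerBlDl => /andP[].
rewrite -lee_pdivlMl//.
apply: le_limf_esup_powR; first by rewrite invr_gt0.
move=> eps eps0.
have aeps : 0 < a * eps by rewrite mulr_gt0.
have ai : 0 < a^-1 by rewrite invr_gt0.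
have := near_powR_at_right0 ai (uv _ aeps).
have : \forall r \near 0^'+, (0 : R) < r by exact: nbhs_right_gt.
apply: filterS2 => r r0 /=.
rewrite -powRrM mulVf ?gt_eqF// (powRr1 (ltW r0)) ler_norml => /andP[+ _].
rewrite lerBrDr -(ler_pM2l ai) mulrDr mulrN !mulrA mulVf ?gt_eqF// !mul1r.
lra.
Qed.

Lemma limf_einf_powR (R : realType) (a : R) (u v : R -> R) : 0 < a ->
  (forall eps : R, 0 < eps ->
     \forall r \near 0^'+, `|u r - a * v (r `^ a)| <= eps) ->
  limf_einf (EFin \o u) 0^'+ = (a%:E * limf_einf (EFin \o v) 0^'+)%E.
Proof.
move=> a0 uv; rewrite /limf_einf muleN; congr (- _)%E.
apply: (limf_esup_powR (u := fun r => - u r) (v := fun r => - v r) a0) => eps /uv.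
by apply: filterS => r; rewrite mulrN opprK -normrN opprD opprK.
Qed.

Lemma near_lnV_small (R : realType) (K eps : R) : 0 < eps ->
  \forall r \near 0^'+, K <= eps * - ln r.
Proof.
move=> eps0.
have : \forall r \near 0^'+, r < expR (- K / eps).
  by apply: nbhs_right_lt; exact: expR_gt0.
have : \forall r \near 0^'+, (0 : R) < r by exact: nbhs_right_gt.
apply: filterS2 => r r0 rK.
have : ln r <= - K / eps by rewrite -[leRHS]expRK ler_ln ?posrE ?expR_gt0// ltW.
by rewrite ler_pdivlMr// mulrC; lra.
Qed.

(** Multiplicative errors of the form [K * r `^ - eps], with [eps] arbitrarily
    small, disappear once logarithms are divided by [- ln r]. *)
Lemma ln_ratio_near (R : realType) (a : R) (x c : R -> R) : 0 < a ->
  (forall r, 0 < r -> 0 < c r) ->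
  (\forall r \near 0^'+, 0 < x r) ->
  (forall eps : R, 0 < eps -> exists2 K, 0 < K &
     \forall r \near 0^'+, c (r `^ a) * r `^ eps <= K * x r) ->
  (forall eps : R, 0 < eps -> exists2 K, 0 < K &
     \forall r \near 0^'+, x r * r `^ eps <= K * c (r `^ a)) ->
  forall eps : R, 0 < eps -> \forall r \near 0^'+,
    `|ln (x r) / - ln r - a * (ln (c (r `^ a)) / - ln (r `^ a))| <= eps.
Proof.
move=> a0 c_gt0 x_gt0 cx xc eps eps0.
have eps20 : 0 < eps / 2 by rewrite divr_gt0.
have [K K0 HK] := cx _ eps20; have [L L0 HL] := xc _ eps20.
have HlnK := near_lnV_small (ln K) eps20.
have HlnL := near_lnV_small (ln L) eps20.
have near_gt0 : \forall r \near 0^'+, (0 : R) < r by exact: nbhs_right_gt.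
have near_lt1 : \forall r \near 0^'+, r < (1 : R) by exact: nbhs_right_lt.
near=> r.
have r0 : 0 < r by near: r.
have r1 : r < 1 by near: r.
have xr0 : 0 < x r by near: r.
have cr0 : 0 < c (r `^ a) by apply: c_gt0; rewrite powR_gt0.
have l0 : 0 < - ln r by rewrite oppr_gt0 ln_lt0// r0.
have lne0 : - ln r != 0 by rewrite gt_eqF.
have pe : 0 < r `^ (eps / 2) by rewrite powR_gt0.
have h1 : ln (c (r `^ a)) + eps / 2 * ln r <= ln K + ln (x r).
  rewrite -ln_powR -!lnM ?posrE// ler_ln ?posrE ?mulr_gt0//.
  by near: r.
have h2 : ln (x r) + eps / 2 * ln r <= ln L + ln (c (r `^ a)).
  rewrite -ln_powR -!lnM ?posrE// ler_ln ?posrE ?mulr_gt0//.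
  by near: r.
have h3 : ln K <= eps / 2 * - ln r by near: r.
have h4 : ln L <= eps / 2 * - ln r by near: r.
rewrite [ln (r `^ a)]ln_powR.
have -> : a * (ln (c (r `^ a)) / - (a * ln r)) = ln (c (r `^ a)) / - ln r.
  by field; rewrite (gt_eqF a0) -oppr_eq0 lne0.
rewrite -mulrBl normrM (gtr0_norm (x:=(- ln r)^-1)) ?invr_gt0//.
rewrite ler_pdivrMr// ler_norml; apply/andP; split; lra.
Unshelve. all: by end_near. Qed.

(** * Row vectors: Euclidean norm, Borel sets *)

Section enorm.
Context (R : realType) (n : nat).
Implicit Types x y : 'rV[R]_n.

Lemma enorm_ge0 x : 0 <= enorm x.
Proof. exact: sqrtr_ge0. Qed.

Lemma enorm0 : enorm (0 : 'rV[R]_n) = 0.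
Proof.
by rewrite /enorm big1 ?sqrtr0// => i _; rewrite mxE expr0n.
Qed.

Lemma ler_coord_enorm x i : `|x ord0 i| <= enorm x.
Proof.
rewrite -sqrtr_sqr /enorm ler_wsqrtr// (bigD1 i)//= lerDl.
by apply: sumr_ge0 => j _; exact: sqr_ge0.
Qed.

Lemma ler_coord_norm x i : `|x ord0 i| <= `|x|.
Proof.
rewrite /Num.norm/= mx_normrE.
by apply: (le_bigmax _ (fun ij : 'I_1 * 'I_n => `|x ij.1 ij.2|) (ord0, i)).
Qed.

Lemma ler_norm_coord x a :
  0 <= a -> (forall i, `|x ord0 i| <= a) -> `|x| <= a.
Proof.
move=> a0 xa; rewrite [leLHS]/Num.norm/= mx_normrE.
by apply/bigmax_leP; split => // -[i j] _ /=; rewrite (ord1 i).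
Qed.

Lemma ler_norm_enorm x : `|x| <= enorm x.
Proof.
by apply: ler_norm_coord => [|i]; [exact: enorm_ge0|exact: ler_coord_enorm].
Qed.

Lemma ler_enorm_norm x : enorm x <= Num.sqrt n%:R * `|x|.
Proof.
rewrite -[`|x|]ger0_norm// -sqrtr_sqr -sqrtrM ?ler0n// ler_wsqrtr//.
have -> : n%:R * `|x| ^+ 2 = \sum_(i < n) `|x| ^+ 2.
  by rewrite sumr_const card_ord mulr_natl.
apply: ler_sum => i _; rewrite -real_normK ?num_real// -[leRHS]real_normK ?num_real//.
by rewrite ler_sqr ?nnegrE// normr_id ler_coord_norm.
Qed.

Lemma enorm_eq0 x : (enorm x == 0) = (x == 0).
Proof.
apply/idP/eqP => [/eqP x0|->]; last by rewrite enorm0.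
by apply/eqP; rewrite -normr_le0 -x0 ler_norm_enorm.
Qed.

Lemma enorm_continuous : continuous (@enorm R n).
Proof.
move=> x; apply: continuous_comp; last exact: sqrt_continuous.
apply: continuous_big => [|i _ y]; first exact: add_continuous.
apply: (@continuous_comp _ _ _ (fun y : 'rV[R]_n => y ord0 i)
  (fun z : R => z ^+ 2)); first exact: coord_continuous.
exact: exprn_continuous.
Qed.

(** Open sets generate the Borel sets on both sides. *)
Lemma continuous_borel_measurable (f : 'rV[R]_n -> R) :
  continuous f -> measurable_fun [set: borel_rV R n] f.
Proof.
move=> /continuousP cf; apply: (measurability _ (RGenOpens.measurableE R)).
move=> _ [_ [a [b ->]] <-]; rewrite setTI; apply: sub_sigma_algebra.
by apply: cf; exact: interval_open.
Qed.

Lemma compact_borel_measurable (E : set 'rV[R]_n) :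
  compact E -> measurable (E : set (borel_rV R n)).
Proof.
move=> cE; rewrite -[E]setCK; apply: measurableC; apply: sub_sigma_algebra.
apply: closed_openC; apply: compact_closed => //; exact: norm_hausdorff.
Qed.

End enorm.

Lemma compact_norm_le_nat (R : realType) (V : normedModType R) (E : set V) :
  compact E -> exists N : nat, forall z, E z -> `|z| <= N%:R.
Proof.
move=> /compact_bounded[M [_ EM]]; exists (Num.truncn `|M + 1|).+1 => z Ez.
apply: (@le_trans _ _ (M + 1)); first by apply: EM; rewrite ?ltrDl.
by apply: (le_trans (ler_norm _)); apply/ltW/truncnS_gt.
Qed.

(** * Real powers and the kernel *)

Lemma ler_powR2r (R : realType) (s x y : R) :
  0 <= s -> 0 <= x -> x <= y -> x `^ s <= y `^ s.
Proof.
move=> s0 x0 xy; apply: ge0_ler_powR => //; rewrite nnegrE//.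
exact: le_trans xy.
Qed.

Lemma one_powR (R : realType) (s : R) : 1 `^ s = 1.
Proof. by rewrite powR1. Qed.

Lemma powR_le1 (R : realType) (x s : R) : 0 <= x -> x <= 1 -> 0 <= s ->
  x `^ s <= 1.
Proof. by move=> x0 x1 s0; rewrite -(one_powR s); exact: ler_powR2r. Qed.

Lemma powR_lt1 (R : realType) (x s : R) : 0 <= x -> x < 1 -> 0 < s ->
  x `^ s < 1.
Proof.
by move=> x0 x1 s0; rewrite -(one_powR s); apply: gt0_ltr_powR;
  rewrite ?nnegrE.
Qed.

Lemma powR_div (R : realType) (x y s : R) : 0 <= x -> 0 <= y ->
  (x / y) `^ s = x `^ s / y `^ s.
Proof.
move=> x0 y0; rewrite powRM ?invr_ge0// -(powR_inv1 y0) -powRrM mulN1r.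
by rewrite powRN.
Qed.

Lemma powR_exprn (R : realType) (x s : R) k : 0 <= x ->
  (x ^+ k) `^ s = (x `^ s) ^+ k.
Proof.
move=> x0; rewrite -(powR_mulrn k x0) -(powR_mulrn k (powR_ge0 x s)).
by rewrite -!powRrM mulrC.
Qed.

Section kernel.
Context (R : realType) (n : nat).
Implicit Types (x y : 'rV[R]_n) (r s : R).

(** Closed form of the kernel, valid at the origin as well. *)
Definition phi s r x : R := (r / Num.max r (enorm x)) `^ s.

Lemma kernel_phiE r s x : 0 < r -> 0 < s -> kernel_phi r s x = phi s r x.
Proof.
move=> r0 s0; rewrite /kernel_phi /phi.
have [->|x0] := eqVneq x 0.
  by rewrite enorm0 (max_l (ltW r0)) divff ?gt_eqF// powR1.
have e0 : 0 < enorm x by rewrite lt_neqAle enorm_ge0 eq_sym enorm_eq0 x0.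
case: (leP r (enorm x)) => re; [rewrite min_r//|rewrite min_l ?divff ?gt_eqF// ?powR1//].
  rewrite -[leRHS](one_powR s); apply: ler_powR2r; first exact: ltW.
    by rewrite divr_ge0// ltW.
  by rewrite ler_pdivrMr// mul1r.
rewrite -[leLHS](one_powR s); apply: ler_powR2r => //; first exact: ltW.
by rewrite ler_pdivlMr// mul1r ltW.
Qed.

Lemma phi_ge0 s r x : 0 <= phi s r x.
Proof. exact: powR_ge0. Qed.

Lemma measurable_phi s r (f : 'rV[R]_n -> 'rV[R]_n) : 0 < r -> continuous f ->
  measurable_fun [set: borel_rV R n] (fun y => phi s r (f y)).
Proof.
move=> r0 cf.
apply: (measurableT_comp (measurable_powR s)).
apply: (measurableT_comp (f := fun e : R => r / Num.max r e)).
  apply: continuous_measurable_fun => y.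
  apply: cvgM; first exact: cvg_cst.
  apply: cvgV; first by rewrite gt_eqF// lt_max r0.
  by apply: (@continuous_max _ _ (cst r) id) => //; exact: cvg_cst.
apply: continuous_borel_measurable => y.
by apply: continuous_comp; [exact: cf|exact: enorm_continuous].
Qed.

(** The kernel at scale [r] does not see displacements of order [r]. This is
    what allows measures to be concentrated on one point per cell of a grid of
    mesh [r]; the bound [2 * r] accounts for moving both points of a pair. *)
Lemma phi_comparable s r x y : (0 < n)%N -> 0 < r -> 0 < s ->
  `|x - y| <= r *+ 2 ->
  phi s r x <= (Num.sqrt n%:R * 3) `^ s * phi s r y.
Proof.
move=> n0 r0 s0 xy.
have q1 : 1 <= Num.sqrt n%:R :> R by rewrite -[leLHS]sqrtr1 ler_wsqrtr// ler1n.
have q0 := lt_le_trans ltr01 q1.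
have mx0 : 0 < Num.max r (enorm x) by rewrite lt_max r0.
have my0 : 0 < Num.max r (enorm y) by rewrite lt_max r0.
rewrite /phi -powRM ?mulr_ge0 ?invr_ge0 ?(ltW r0) ?(ltW my0) ?sqrtr_ge0//.
apply: ler_powR2r; [exact: ltW|by rewrite divr_ge0// ltW|].
rewrite mulrCA ler_pM2l// ler_pdivlMr// mulrC ler_pdivrMr//.
have m3 : `|y| <= 3 * Num.max r (enorm x).
  have : `|y| <= `|x| + `|x - y|.
    by rewrite distrC -{1}(subrK x y) addrC ler_normD.
  have := ler_norm_enorm x.
  have : enorm x <= Num.max r (enorm x) by rewrite le_max lexx orbT.
  have : r <= Num.max r (enorm x) by rewrite le_max lexx.
  rewrite mulr2n in xy; lra.
rewrite ge_max; apply/andP; split.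
  rewrite (@le_trans _ _ (1 * Num.max r (enorm x)))//.
    by rewrite mul1r le_max lexx.
  by rewrite ler_pM2r//; lra.
apply: (le_trans (ler_enorm_norm y)).
by rewrite -mulrA ler_pM2l.
Qed.

(** Used to pass from an arbitrary scale to a dyadic one. *)
Lemma phi_scale s r r' x : 0 < r -> r <= r' -> 0 < s ->
  phi s r' x <= (r' / r) `^ s * phi s r x.
Proof.
move=> r0 rr' s0; have r'0 := lt_le_trans r0 rr'.
have mx0 : 0 < Num.max r (enorm x) by rewrite lt_max r0.
have mx0' : 0 < Num.max r' (enorm x) by rewrite lt_max r'0.
rewrite /phi -powRM ?divr_ge0 ?(ltW r0) ?(ltW r'0) ?(ltW mx0)//.
apply: ler_powR2r; [exact: ltW|by rewrite divr_ge0// ltW|].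
rewrite mulrA divfK ?gt_eqF// ler_pM2l// lef_pV2 ?posrE//.
by rewrite ge_max !le_max rr' lexx !orbT.
Qed.

End kernel.

(** * Integration *)

Section integral_extra.
Context d (T : measurableType d) (R : realType).
Local Open Scope ereal_scope.

(** The integral of a nonnegative function is a supremum over the simple
    functions below it, so monotonicity holds without measurability. *)
Lemma ge0_le_integral_nonmeasurable (mu : {measure set T -> \bar R})
    (f g : T -> \bar R) :
  (forall x, 0 <= f x) -> (forall x, f x <= g x) ->
  \int[mu]_x f x <= \int[mu]_x g x.
Proof.
move=> f0 fg; rewrite !ge0_integralTE//; last first.
  by move=> x; exact: le_trans (fg x).
apply: le_ereal_sup => _ [h hf <-]; exists h => // x.
exact: le_trans (fg x).
Qed.

Lemma integral_sum_indic (mu : {measure set T -> \bar R}) (I : finType)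
    (c : I -> R) (Q : I -> set T) :
  (forall i, 0 <= c i)%R -> (forall i, measurable (Q i)) ->
  \int[mu]_x (\sum_i c i * \1_(Q i) x)%:E = \sum_i (c i)%:E * mu (Q i).
Proof.
move=> c0 mQ; under eq_integral do rewrite -sumEFin.
rewrite ge0_integral_sum//; last 2 first.
  by move=> i; apply/measurable_EFinP/measurable_funM => //.
  by move=> i x _; rewrite lee_fin mulr_ge0.
apply: eq_bigr => i _; under eq_integral do rewrite EFinM.
rewrite ge0_integralZl//; last by rewrite lee_fin.
  by rewrite integral_indic// setIT.
exact/measurable_EFinP/measurable_indic.
Qed.

Lemma discrete_probability (I : finType) (p : I -> R) (x : I -> T) :
  (forall i, 0 <= p i)%R -> (\sum_i p i = 1)%R ->
  exists mu : probability T R,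
    (forall A, measurable A -> mu A = \sum_i (p i)%:E * \d_(x i) A) /\
    forall f : T -> \bar R, measurable_fun [set: T] f ->
      (forall y, 0 <= f y) -> \int[mu]_y f y = \sum_i (p i)%:E * f (x i).
Proof.
move=> p0 p1.
have [i0 _] : exists i : I, True.
  apply: contrapT => /forallNP noI; move: p1.
  rewrite big1 => [/esym/eqP|i]; first by rewrite oner_eq0.
  by have := noI i.
have sumI (F : I -> \bar R) :
    \sum_(k < #|I|) F (nth i0 (enum I) k) = \sum_i F i.
  by rewrite -[RHS]big_enum/= [RHS](big_nth i0) [RHS]big_mkord -cardE.
pose m (k : nat) : {measure set T -> \bar R} :=
  mscale (NngNum (p0 (nth i0 (enum I) k))) (\d_(x (nth i0 (enum I) k))).
pose M : {measure set T -> \bar R} := msum m #|I|.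
have ME A : M A = \sum_i (p i)%:E * \d_(x i) A by rewrite -sumI.
have MT : M setT = 1.
  rewrite ME; under eq_bigr do rewrite diracT mule1.
  by rewrite sumEFin p1.
(* The total mass is [1], so normalizing only supplies the structure of a
   probability measure. *)
pose P : probability T R := mnormalize M \d_(x i0).
have PM A : P A = M A.
  rewrite /P/= /mnormalize MT/= onee_eq0/=.
  by rewrite invr1 mule1.
exists P; split=> [A mA|f mf f0]; first by rewrite PM ME.
rewrite (eq_measure_integral M) => [|A _ _]; last exact: PM.
rewrite ge0_integral_measure_sum// -sumI; apply: eq_bigr => k _.
rewrite ge0_integral_mscale//= integral_dirac//.
by rewrite diracT mul1e.
Qed.

End integral_extra.

(** * Grid cells *)

Section cells.
Context (R : realType) (n : nat).
Implicit Types (z : 'rV[R]_n) (N : nat) (eta : R).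

(** The cell that contains [z] in the half-open grid of mesh [eta] with corner
    [(-N, .., -N)]. Only the values on the box [[-N, N]^n] are meaningful. *)
Definition cell N eta z :
    {ffun 'I_n -> 'I_(Num.truncn (N.*2%:R / eta)).+1} :=
  [ffun l => inord (Num.truncn ((z ord0 l + N%:R) / eta))].

Lemma cellE N eta z l : 0 < eta -> `|z| <= N%:R ->
  cell N eta z l = Num.truncn ((z ord0 l + N%:R) / eta) :> nat.
Proof.
move=> eta0 zN; rewrite ffunE inordK// ltnS le_truncn//.
rewrite ler_pM2r ?invr_gt0// -addnn natrD lerD2r.
exact: le_trans (le_trans (ler_norm _) (ler_coord_norm z l)) zN.
Qed.

Lemma cell_itv N eta z l : 0 < eta -> `|z| <= N%:R ->
  (cell N eta z l)%:R * eta <= z ord0 l + N%:R < (cell N eta z l).+1%:R * eta.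
Proof.
move=> eta0 zN; rewrite cellE//.
rewrite -ler_pdivlMr// -ltr_pdivrMr//; apply: truncn_itv.
apply: divr_ge0; last exact: ltW.
have := ler_coord_norm z l; rewrite ler_norml => /andP[zl _].
by rewrite -lerBlDr sub0r (le_trans _ zl)// lerN2.
Qed.

Lemma cell_eqP N eta z (a : {ffun 'I_n -> 'I_(Num.truncn (N.*2%:R / eta)).+1}) :
  0 < eta -> `|z| <= N%:R ->
  cell N eta z = a <->
  forall l, (a l)%:R * eta <= z ord0 l + N%:R < (a l).+1%:R * eta.
Proof.
move=> eta0 zN; split=> [<- l|za]; first exact: cell_itv.
apply/ffunP => l; apply/val_inj; rewrite /= cellE//.
by apply: truncn_def; rewrite ler_pdivlMr// ltr_pdivrMr.
Qed.

Lemma cell_dist N eta z z' : 0 < eta -> `|z| <= N%:R -> `|z'| <= N%:R ->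
  cell N eta z = cell N eta z' -> `|z - z'| <= eta.
Proof.
move=> eta0 zN z'N zz'; apply: ler_norm_coord => [|l]; first exact: ltW.
have := cell_itv l eta0 zN; have := cell_itv l eta0 z'N.
rewrite zz' !mxE -natr1 mulrDl mul1r ler_norml => /andP[? ?] /andP[? ?].
by apply/andP; split; lra.
Qed.

(** Distinct cells may be adjacent, whence the extra [eta]. *)
Lemma cell_coord_dist N eta z z' l : 0 < eta ->
  `|z| <= N%:R -> `|z'| <= N%:R ->
  `|(cell N eta z l)%:R - (cell N eta z' l)%:R| * eta
    <= `|z ord0 l - z' ord0 l| + eta.
Proof.
move=> eta0 zN z'N.
have := cell_itv l eta0 zN; have := cell_itv l eta0 z'N.
rewrite -!natr1 !mulrDl mul1r => /andP[? ?] /andP[? ?].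
rewrite -[X in _ * X <= _](gtr0_norm eta0) -normrM mulrBl ler_norml.
have := ler_norm (z ord0 l - z' ord0 l).
have := lerNnormlW (lexx `|z ord0 l - z' ord0 l|).
by move=> ? ?; apply/andP; split; lra.
Qed.

Lemma measurable_cell N eta (E : set 'rV[R]_n)
    (a : {ffun 'I_n -> 'I_(Num.truncn (N.*2%:R / eta)).+1}) :
  0 < eta -> measurable (E : set (borel_rV R n)) ->
  (forall z, E z -> `|z| <= N%:R) ->
  measurable (E `&` [set z | cell N eta z = a] : set (borel_rV R n)).
Proof.
move=> eta0 mE EN.
have -> : E `&` [set z | cell N eta z = a] =
    E `&` \bigcap_(l in [set: 'I_n])
      ((fun z : 'rV[R]_n => z ord0 l) @^-1`
         `[(a l)%:R * eta - N%:R, (a l).+1%:R * eta - N%:R[).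
  apply/seteqP; split=> z [Ez za]; split=> //=.
    move=> l _ /=; rewrite in_itv/= lerBlDr ltrBrDr.
    by move/(cell_eqP _ eta0 (EN _ Ez)): za; exact.
  apply/(cell_eqP _ eta0 (EN _ Ez)) => l.
  by have := za l I; rewrite /= in_itv/= lerBlDr ltrBrDr.
apply: measurableI => //; apply: fin_bigcap_measurable => // l _.
rewrite -[X in measurable X]setTI.
apply: (continuous_borel_measurable (f := fun z : 'rV[R]_n => z ord0 l)) => //.
exact: coord_continuous.
Qed.

End cells.

(** * Capacity and finite energies *)

Section capacity.
Context (R : realType) (n : nat).
Implicit Types (E : set 'rV[R]_n) (r s : R).

Definition finite_energy s r (I : finType) (p : I -> R)
    (x : I -> 'rV[R]_n) : R :=
  \sum_i \sum_j p i * p j * phi s r (x i - x j).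

Definition weights_in E (I : finType) (p : I -> R)
    (x : I -> 'rV[R]_n) : Prop :=
  [/\ forall i, 0 <= p i, \sum_i p i = 1 & forall i, E (x i)].

Lemma energyE r s mu : 0 < r -> 0 < s ->
  energy r s mu =
  (\int[mu]_x \int[mu]_y (phi s r ((x : 'rV[R]_n) - y))%:E)%E.
Proof.
move=> r0 s0; apply: eq_integral => x _; apply: eq_integral => y _.
by rewrite kernel_phiE.
Qed.

Lemma energy_discrete E r s (I : finType) (p : I -> R)
    (x : I -> 'rV[R]_n) :
  0 < r -> 0 < s -> measurable (E : set (borel_rV R n)) ->
  weights_in E p x ->
  exists2 mu, supported_by E mu & energy r s mu = (finite_energy s r p x)%:E.
Proof.
move=> r0 s0 mE [p0 p1 Ex].
have [mu [muE mu_int]] :=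
  discrete_probability (T := borel_rV R n) x p0 p1.
exists mu.
  rewrite /supported_by muE ?big1// => [i _|]; last exact: measurableC.
  by rewrite diracE memNset ?mule0//= => /(_ (Ex i)).
rewrite energyE//.
under eq_integral => y _.
  rewrite mu_int; last 2 first.
    apply/measurable_EFinP; apply: (measurable_phi s (f := fun z => y - z)) => //.
    move=> z; apply: (@continuousB R _ _ (cst (y : 'rV[R]_n)) id) => //.
    exact: cst_continuous.
    by move=> z; rewrite lee_fin phi_ge0.
  under eq_bigr do rewrite -EFinM.
  rewrite sumEFin.
  over.
rewrite /= mu_int; last 2 first.
  apply/measurable_EFinP; apply: measurable_sum => i.
  apply: measurable_funM => //.
  apply: (measurable_phi s (f := fun z => z - x i)) => // z.
  apply: (@continuousB R _ _ id (cst (x i : 'rV[R]_n))) => //.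
  exact: cst_continuous.
  by move=> y; rewrite lee_fin sumr_ge0// => i _; rewrite mulr_ge0// phi_ge0.
under eq_bigr do rewrite -EFinM.
rewrite sumEFin; congr EFin; apply: eq_bigr => i _.
by rewrite mulr_sumr; apply: eq_bigr => j _; rewrite mulrA.
Qed.

(** Give to one point of each cell of mesh [r] the mass of the cell. The
    measurability of the inner integral as a function of the outer variable is
    never required, since only monotonicity is used for the outer integral. *)
Lemma finite_energy_le_energy E r s mu : (0 < n)%N -> 0 < r -> 0 < s ->
  compact E -> E !=set0 -> supported_by E mu ->
  exists (I : finType) (p : I -> R) (x : I -> 'rV[R]_n),
    weights_in E p x /\
    ((finite_energy s r p x)%:E <=
       ((Num.sqrt n%:R * 3) `^ s)%:E * energy r s mu)%E.
Proof.
move=> n0 r0 s0 cE [e0 Ee0] muE.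
have mE : measurable (E : set (borel_rV R n)) by exact: compact_borel_measurable.
have [N EN] := compact_norm_le_nat cE.
pose I : finType := {ffun 'I_n -> 'I_(Num.truncn (N.*2%:R / r)).+1}.
pose Q (a : I) : set (borel_rV R n) := E `&` [set z | cell N r z = a].
have mQ a : measurable (Q a) by exact: measurable_cell.
pose x (a : I) : 'rV[R]_n := xget e0 (Q a).
have xQ a z : Q a z -> Q a (x a) by move=> Qz; apply: xgetPex; exists z.
have Ex a : E (x a) by rewrite /x; case: xgetP => // z _ [].
pose p (a : I) : R := fine (mu (Q a)).
have pE a : (p a)%:E = mu (Q a) by rewrite fineK// fin_num_measure.
have p0 a : 0 <= p a by rewrite fine_ge0.
pose K := (Num.sqrt n%:R * 3) `^ s : R.
have K0 : 0 < K.
  by rewrite powR_gt0// mulr_gt0// sqrtr_gt0 ltr0n.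
have sum_indic (c : I -> R) z : \sum_a c a * \1_(Q a) z =
    if z \in E then c (cell N r z) else 0.
  case: ifPn => [/[!inE] Ez|/negP Ez].
    rewrite (bigD1 (cell N r z))//= indicE mem_set// mulr1 big1 ?addr0//.
    move=> a az; rewrite indicE memNset ?mulr0// => -[_ /= za].
    by move: az; rewrite za eqxx.
  rewrite big1// => a _; rewrite indicE memNset ?mulr0// => -[Ez' _].
  by apply: Ez; rewrite inE.
exists I, p, x; split.
  split=> //.
  have muE1 : mu E = 1%E.
    by rewrite -[E]setCK probability_setC ?muE ?sube0//; exact: measurableC.
  apply: EFin_inj; rewrite -sumEFin -muE1.
  under eq_bigr do rewrite pE -[mu _]mul1e.
  rewrite -(integral_sum_indic _ (c := fun=> 1)) => //.
  have -> : mu E = (\int[mu]_z (\1_E z)%:E)%E by rewrite integral_indic// setIT.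
  apply: eq_integral => z _.
  by rewrite sum_indic indicE; case: ifP.
have Kn : K%:E != 0%E by rewrite gt_eqF// lte_fin.
rewrite -lee_pdivrMl//.
rewrite -EFinM energyE//.
(* The step function with value [v a] on [Q a] is below the potential of
   [mu]. *)
pose v a := \sum_b K^-1 * phi s r (x a - x b) * p b.
have v0 a : 0 <= v a.
  by apply: sumr_ge0 => b _; rewrite !mulr_ge0 ?phi_ge0// invr_ge0 ltW.
have -> : (K^-1 * finite_energy s r p x)%:E = (\sum_a (v a)%:E * mu (Q a))%E.
  under [in RHS]eq_bigr do rewrite -pE -EFinM.
  rewrite sumEFin mulr_sumr; congr EFin; apply: eq_bigr => a _.
  rewrite mulr_suml mulr_sumr; apply: eq_bigr => b _; ring.
rewrite -integral_sum_indic//.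
apply: ge0_le_integral_nonmeasurable => z.
  by rewrite lee_fin; apply: sumr_ge0 => a _; rewrite mulr_ge0.
rewrite sum_indic; case: ifPn => [/[!inE] Ez|_]; last first.
  by apply: integral_ge0 => y _; rewrite lee_fin phi_ge0.
set a := cell N r z.
have Qaz : Q a z by [].
have -> : (v a)%:E =
    (\sum_b (K^-1 * phi s r (x a - x b))%:E * mu (Q b))%E.
  by under eq_bigr do rewrite -pE -EFinM; rewrite sumEFin.
rewrite -integral_sum_indic//; last first.
  by move=> b; rewrite mulr_ge0 ?phi_ge0// invr_ge0 ltW.
apply: ge0_le_integral_nonmeasurable => y.
  rewrite lee_fin; apply: sumr_ge0 => b _.
  by rewrite !mulr_ge0 ?phi_ge0// invr_ge0 ltW.
rewrite sum_indic; case: ifPn => [/[!inE] Ey|_]; last by rewrite lee_fin phi_ge0.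
set b := cell N r y.
have Qby : Q b y by [].
rewrite lee_fin ler_pdivrMl//.
apply: phi_comparable => //.
have [Exa xa] := xQ _ _ Qaz; have [Exb xb] := xQ _ _ Qby.
have -> : x a - x b - (z - y) = (x a - z) - (x b - y).
  by apply/rowP => i; rewrite !mxE; ring.
rewrite mulr2n; apply: (le_trans (ler_normB _ _)); apply: lerD.
  by apply: (cell_dist r0 (EN _ Exa) (EN _ Ez)); rewrite xa.
by apply: (cell_dist r0 (EN _ Exb) (EN _ Ey)); rewrite xb.
Qed.

(** Capacity in terms of finite energies: exact in one direction, up to the
    constant of [phi_comparable] in the other. The factor [2] makes the
    existence of a minimizing measure unnecessary. *)
Lemma capacity_finite_energy E r s : (0 < n)%N -> 0 < r -> 0 < s ->
  compact E -> E !=set0 ->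
  exists c, [/\ 0 < c, capacity r s E = c%:E,
    forall (I : finType) (p : I -> R) (x : I -> 'rV[R]_n), weights_in E p x ->
      1 <= c * finite_energy s r p x &
    exists (I : finType) (p : I -> R) (x : I -> 'rV[R]_n), weights_in E p x /\
      c * finite_energy s r p x <= 2 * (Num.sqrt n%:R * 3) `^ s].
Proof.
move=> n0 r0 s0 cE E0; have [e0 Ee0] := E0.
have mE : measurable (E : set (borel_rV R n)) by exact: compact_borel_measurable.
set K := (Num.sqrt n%:R * 3) `^ s.
have K0 : 0 < K.
  by rewrite powR_gt0// mulr_gt0// sqrtr_gt0 ltr0n.
pose J := ereal_inf [set energy r s mu | mu in supported_by E].
have le_J (I : finType) (p : I -> R) (x : I -> 'rV[R]_n) : weights_in E p x ->
    (J <= (finite_energy s r p x)%:E)%E.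
  move=> /(energy_discrete r0 s0 mE)[mu muE <-].
  by apply: ereal_inf_lbound; exists mu.
have [N EN] := compact_norm_le_nat cE.
pose D := Num.sqrt n%:R * (N%:R + N%:R) : R.
have D0 : 0 <= D by rewrite mulr_ge0// ?sqrtr_ge0// addr_ge0.
(* [b] is the smallest value that the kernel can take on a box that contains
   [E]. *)
pose b := (r / (r + D)) `^ s.
have b0 : 0 < b by rewrite powR_gt0// divr_gt0// ltr_pwDl.
have b_phi x y : E x -> E y -> b <= phi s r (x - y).
  move=> Ex Ey; have m0 : 0 < Num.max r (enorm (x - y)) by rewrite lt_max r0.
  apply: ler_powR2r; [exact: ltW|by rewrite divr_ge0 ?addr_ge0// ltW|].
  rewrite ler_pM2l// lef_pV2 ?posrE ?ltr_pwDl// ge_max lerDl D0/=.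
  apply: (le_trans (ler_enorm_norm _)); rewrite -[leLHS]add0r.
  apply: lerD; first exact: ltW.
  rewrite ler_wpM2l ?sqrtr_ge0//; apply: (le_trans (ler_normB _ _)).
  by apply: lerD; exact: EN.
have b_energy (I : finType) (p : I -> R) (x : I -> 'rV[R]_n) : weights_in E p x ->
    b <= finite_energy s r p x.
  move=> [p0 p1 Ex]; rewrite -[b]mul1r -[X in X * _ <= _]mul1r -{1}p1 -p1.
  rewrite !mulr_suml; apply: ler_sum => i _.
  rewrite mulr_sumr mulr_suml; apply: ler_sum => j _.
  by rewrite ler_wpM2l ?mulr_ge0// b_phi.
have J_gt0 : (0 < J)%E.
  apply: (@lt_le_trans _ _ (K^-1 * b)%:E); first by rewrite lte_fin mulr_gt0// invr_gt0.
  apply: le_ereal_inf_tmp => _ [mu muE <-].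
  have [I [p [x [wx xmu]]]] := finite_energy_le_energy n0 r0 s0 cE E0 muE.
  rewrite EFinM -lee_pdivlMl ?lte_fin ?invr_gt0//= invrK.
  by apply: le_trans xmu; rewrite lee_fin b_energy.
have J_lty : (J < +oo)%E.
  have /le_J : weights_in E (fun _ : unit => 1) (fun=> e0).
    by split=> //; rewrite sumr_const card_unit.
  by move=> /le_lt_trans; apply; rewrite ltry.
have JE : J = (fine J)%:E by rewrite fineK// gt0_fin_numE.
have j0 : 0 < fine J by rewrite -lte_fin -JE.
exists (fine J)^-1; split.
- by rewrite invr_gt0.
- by rewrite /capacity -/J JE inver gt_eqF.
- by move=> I p x /le_J; rewrite JE lee_fin mulrC ler_pdivlMr// mul1r.
have : (J < (2 * fine J)%:E)%E by rewrite {1}JE lte_fin ltr_pMl// ltr1n.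
move=> /ereal_inf_lt[_ [mu muE <-] muJ].
have [I [p [x [wx xmu]]]] := finite_energy_le_energy n0 r0 s0 cE E0 muE.
exists I, p, x; split=> //.
rewrite mulrC ler_pdivrMr// -lee_fin; apply: (le_trans xmu).
rewrite [2 * K]mulrC -mulrA EFinM lee_pmul2l ?lte_fin//.
exact: ltW.
Qed.

End capacity.

Section capacity_real.
Context (R : realType) (n : nat) (E : set 'rV[R]_n) (s : R).
Hypotheses (n_gt0 : (0 < n)%N) (s_gt0 : 0 < s).
Hypotheses (E_compact : compact E) (E_neq0 : E !=set0).

Definition cap r : R := fine (capacity r s E).

Lemma cap_gt0 r : 0 < r -> 0 < cap r.
Proof.
move=> r0; rewrite /cap.
by have [c [c0 -> _ _]] :=
  capacity_finite_energy n_gt0 r0 s_gt0 E_compact E_neq0.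
Qed.

Lemma capE r : 0 < r -> capacity r s E = (cap r)%:E.
Proof.
move=> r0; rewrite /cap.
by have [c [c0 -> _ _]] :=
  capacity_finite_energy n_gt0 r0 s_gt0 E_compact E_neq0.
Qed.

Lemma cap_finite_energy_ge1 r (I : finType) (p : I -> R)
    (x : I -> 'rV[R]_n) : 0 < r ->
  weights_in E p x -> 1 <= cap r * finite_energy s r p x.
Proof.
move=> r0; rewrite /cap.
have [c [c0 -> + _]] :=
  capacity_finite_energy n_gt0 r0 s_gt0 E_compact E_neq0.
exact.
Qed.

Lemma cap_near_minimizer r : 0 < r ->
  exists (I : finType) (p : I -> R) (x : I -> 'rV[R]_n), weights_in E p x /\
    cap r * finite_energy s r p x <= 2 * (Num.sqrt n%:R * 3) `^ s.
Proof.
move=> r0; rewrite /cap.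
by have [c [c0 -> _]] :=
  capacity_finite_energy n_gt0 r0 s_gt0 E_compact E_neq0.
Qed.

Lemma cap_scale r r' : 0 < r -> r <= r' ->
  cap r <= 2 * (Num.sqrt n%:R * 3) `^ s * (r' / r) `^ s * cap r'.
Proof.
move=> r0 rr'; have r'0 := lt_le_trans r0 rr'.
have [I [p [x [wx xr]]]] := cap_near_minimizer r0.
have x1 := cap_finite_energy_ge1 r'0 wx.
have xrr' : finite_energy s r' p x <=
    (r' / r) `^ s * finite_energy s r p x.
  rewrite mulr_sumr; apply: ler_sum => i _; rewrite mulr_sumr.
  apply: ler_sum => j _; have [p0 _ _] := wx.
  by rewrite mulrCA ler_wpM2l ?mulr_ge0// phi_scale.
move: (cap_gt0 r0) (cap_gt0 r'0) (powR_ge0 (r' / r) s).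
move: (cap r) (cap r') (_ `^ s) (2 * _) (finite_energy _ _ _ _)
  (finite_energy _ _ _ _) xr x1 xrr'.
move=> c c' q K e' e ce ce' e'e c0 c'0 q0.
apply: (@le_trans _ _ (c * (c' * (q * e)))).
  apply: ler_peMr; first exact: ltW.
  by apply: (le_trans ce'); rewrite ler_pM2l.
rewrite [leLHS](_ : _ = c * e * (q * c')); last by ring.
by rewrite -[leRHS]mulrA ler_wpM2r// mulr_ge0// ltW.
Qed.

End capacity_real.

(** * Gaussian estimates and the Borel-Cantelli lemma *)

Section normal_bounds.
Context (R : realType).
Implicit Types s a : R.
Local Notation mu := (@lebesgue_measure R).

(** The density is at most [1 / (s * sqrt (2 * pi)) <= 1 / (2 * s)], and the
    interval has length [2 * a]. *)
Lemma normal_prob_centered_itv s a : 0 < s -> 0 <= a ->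
  (normal_prob 0 s `[(- a)%R, a]%classic <= (a / s)%:E)%E.
Proof.
move=> s0 a0; have sn0 : s != 0 by rewrite gt_eqF.
have peak_le : normal_peak s <= (s *+ 2)^-1.
  rewrite /normal_peak lef_pV2 ?posrE; last 2 first.
  - by rewrite sqrtr_gt0 pmulrn_lgt0// mulr_gt0 ?pi_gt0// exprn_gt0.
  - by rewrite pmulrn_lgt0.
  rewrite -[leLHS]ger0_norm ?(mulrn_wge0 _ (ltW s0))// -sqrtr_sqr ler_wsqrtr//.
  have : s ^+ 2 * 2 <= s ^+ 2 * pi by rewrite ler_pM2l ?exprn_gt0// pi_ge2.
  rewrite -(mulr_natr s) exprMn !mulr2n; lra.
rewrite /normal_prob.
apply: (@le_trans _ _ (\int[mu]_(x in `[(- a)%R, a]%classic) (cst (normal_peak s)%:E x))%E).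
  apply: ge0_le_integral => //.
  - by move=> x _; rewrite lee_fin normal_pdf_ge0.
  - apply: measurable_funTS; apply/measurable_EFinP.
    exact: measurable_normal_pdf.
  - by move=> x _; rewrite lee_fin normal_pdf_ub.
rewrite integral_cst//= lebesgue_measure_itv/=.
case: ifPn => _; last by rewrite mule0 lee_fin divr_ge0// ltW.
rewrite -EFinB -EFinM lee_fin opprK -mulr2n.
apply: (@le_trans _ _ ((s *+ 2)^-1 * (a *+ 2))).
  by rewrite ler_wpM2r// mulrn_wge0.
rewrite -[s *+ 2]mulr_natl -[a *+ 2]mulr_natl invfM mulrACA mulVf// mul1r mulrC.
by rewrite lexx.
Qed.

(** Outside [[-a, a]] the Gaussian density of deviation [s] is, up to the
    factor [exp (- a^2 / 4 s^2)], at most [sqrt 2] times the density of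
    deviation [sqrt 2 * s]. *)
Lemma normal_prob_tail s a : 0 < s -> 0 <= a ->
  (normal_prob 0 s (~` `[(- a)%R, a])%classic <=
   (Num.sqrt 2 * expR (- (a / (s *+ 2)) ^+ 2))%:E)%E.
Proof.
move=> s0 a0; have sn0 : s != 0 by rewrite gt_eqF.
have q0 : 0 < Num.sqrt 2 :> R by rewrite sqrtr_gt0.
have t0 : 0 < Num.sqrt 2 * s by rewrite mulr_gt0.
have mA : measurable (~` `[- a, a] : set R) by exact: measurableC.
set c := Num.sqrt 2 * expR _.
have c0 : 0 <= c by rewrite mulr_ge0 ?expR_ge0// ltW.
have mpdf t : measurable_fun setT (fun x : R => (normal_pdf 0 t x)%:E).
  by apply/measurable_EFinP; exact: measurable_normal_pdf.
rewrite /normal_prob.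
apply: (@le_trans _ _ (\int[mu]_(x in (~` `[(- a)%R, a])%classic)
    (c%:E * (normal_pdf 0 (Num.sqrt 2 * s) x)%:E))%E).
  apply: ge0_le_integral => //.
  - by move=> x _; rewrite lee_fin normal_pdf_ge0.
  - exact: measurable_funTS (mpdf _).
  - apply: measurable_funTS; apply/measurable_EFinP/measurable_funM => //.
    exact: measurable_normal_pdf.
  move=> x /= xa; rewrite -EFinM lee_fin !normal_pdfE ?gt_eqF//.
  rewrite /normal_peak /normal_fun subr0.
  have xa2 : a ^+ 2 <= x ^+ 2.
    rewrite -[leRHS]real_normK ?num_real// lerXn2r ?nnegrE// leNgt.
    apply/negP => /ltW; rewrite ler_norml => xa'; apply: xa.
    by rewrite in_itv.
  have -> : (Num.sqrt ((Num.sqrt 2 * s) ^+ 2 * pi *+ 2))^-1 =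
      (Num.sqrt 2)^-1 * (Num.sqrt (s ^+ 2 * pi *+ 2))^-1.
    by rewrite exprMn sqr_sqrtr// -mulrA -mulrnAr sqrtrM// invfM.
  have aux (z D A B : R) : z != 0 -> z * A * (z^-1 * D * B) = D * (A * B).
    by move=> z0; field.
  rewrite /c aux ?gt_eqF//.
  rewrite -expRD ler_wpM2l ?invr_ge0 ?sqrtr_ge0// ler_expR.
  have -> : (Num.sqrt 2 * s) ^+ 2 = 2 * s ^+ 2 by rewrite exprMn sqr_sqrtr.
  have -> : - x ^+ 2 / (2 * s ^+ 2 *+ 2) = - (x ^+ 2 / s ^+ 2) / 4 by field.
  have -> : - x ^+ 2 / (s ^+ 2 *+ 2) = - (x ^+ 2 / s ^+ 2) / 2 by field.
  have -> : - (a / (s *+ 2)) ^+ 2 = - (a ^+ 2 / s ^+ 2) / 4 by field.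
  have : a ^+ 2 / s ^+ 2 <= x ^+ 2 / s ^+ 2.
    by rewrite ler_pM2r// invr_gt0 exprn_gt0.
  lra.
rewrite ge0_integralZl//; last 2 first.
- exact: measurable_funTS (mpdf _).
- by move=> x _; rewrite lee_fin normal_pdf_ge0.
rewrite [leRHS](_ : _ = c%:E * 1)%E; last by rewrite mule1.
apply: lee_wpmul2l; first by rewrite lee_fin.
rewrite -(integral_normal_pdf 0 (Num.sqrt 2 * s)).
apply: ge0_subset_integral => //; first exact: mpdf.
by move=> x _; rewrite lee_fin normal_pdf_ge0.
Qed.

(** The exponential tail beats every power: [u ^+ q.+1 / q.+1`! <= expR u]. *)
Lemma normal_prob_tail_poly (q : nat) : exists2 C : R, 0 < C &
  forall s a, 0 < s -> 0 < a ->
    (normal_prob 0 s (~` `[(- a)%R, a])%classic <= (C * (s / a) ^+ (2 * q.+1))%:E)%E.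
Proof.
exists (Num.sqrt 2 * (q.+1`!%:R * 4 ^+ q.+1)).
  by rewrite !mulr_gt0 ?sqrtr_gt0 ?ltr0n ?fact_gt0// exprn_gt0.
move=> s a s0 a0; apply: (le_trans (normal_prob_tail s0 (ltW a0))).
rewrite lee_fin -[leRHS]mulrA ler_wpM2l ?sqrtr_ge0//.
set u := a / (s *+ 2).
have u0 : 0 < u by rewrite divr_gt0// pmulrn_lgt0.
have u2 : 0 < u ^+ 2 by rewrite exprn_gt0.
rewrite expRN.
have -> : q.+1`!%:R * 4 ^+ q.+1 * (s / a) ^+ (2 * q.+1) =
    ((u ^+ 2) ^+ q.+1 / q.+1`!%:R)^-1.
  have -> : (s / a) ^+ (2 * q.+1) = (((s / a) ^+ 2)) ^+ q.+1 by rewrite -exprM.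
  rewrite invf_div -exprVn -mulrA -exprMn; congr (_ * _ ^+ _).
  by rewrite /u; field; rewrite !gt_eqF.
rewrite lef_pV2 ?posrE ?expR_gt0 ?divr_gt0 ?exprn_gt0 ?ltr0n ?fact_gt0//.
by have := expR_ge1Dxn q (ltW u2); lra.
Qed.

End normal_bounds.

Section borel_cantelli.
Context d (T : measurableType d) (R : realType).
Local Open Scope ereal_scope.

(** The Borel-Cantelli lemma for geometrically small probabilities. *)
Lemma ae_eventually_not (P : {measure set T -> \bar R}) (F : (set T)^nat)
    (C q : R) : (0 <= C)%R -> (0 <= q < 1)%R ->
  (forall k, measurable (F k)) -> (forall k, P (F k) <= (C * q ^+ k)%:E) ->
  {ae P, forall w, exists k0, forall k, (k0 <= k)%N -> ~ F k w}.
Proof.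
move=> C0 /andP[q0 q1] mF PF.
have P0 : P (lim_sup_set F) = 0.
  apply: lim_sup_set_cvg0 => //.
  apply: (@le_lt_trans _ _ (C / (1 - q))%:E); last by rewrite ltry.
  apply: lime_le; first by apply: is_cvg_nneseries => k _ _; exact: measure_ge0.
  apply: nearW => k.
  apply: (@le_trans _ _ (\sum_(0 <= i < k) (C * q ^+ i)%:E)).
    by apply: lee_sum => i _; exact: PF.
  rewrite sumEFin lee_fin -mulr_sumr ler_wpM2l// big_mkord.
  rewrite -[leRHS]mul1r ler_pdivlMr ?subr_gt0//.
  have := subrX1 q k; have : (0 <= q ^+ k)%R by rewrite exprn_ge0.
  set S := (\sum_(i < k) _)%R; move: S (q ^+ k)%R => S x; nra.
exists (lim_sup_set F); split => //.
  by apply: bigcapT_measurable => k; apply: bigcup_measurable => ? _; exact: mF.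
move=> w /= nw k0 _; apply: contrapT => noF; apply: nw; exists k0 => k k0k Fk.
by apply: noF; exists k.
Qed.

End borel_cantelli.

(** * Lower bound for covering numbers *)

Lemma phi_exprE (R : realType) n (a r : R) (m : nat) (x : 'rV[R]_n) :
  phi (m%:R * a) r x = phi a r x ^+ m.
Proof. by rewrite /phi (mulrC m%:R) powRrM powR_mulrn ?powR_ge0. Qed.

Lemma exists_half_exp_lt (R : realType) (e : R) : 0 < e ->
  exists j, 2^-1 ^+ j < e.
Proof.
move=> e0; exists (Num.truncn e^-1).+1.
rewrite exprVn invf_plt ?posrE ?exprn_gt0//.
apply: (@lt_le_trans _ _ (Num.truncn e^-1).+1%:R); first exact: truncnS_gt.
by rewrite -natrX ler_nat ltnW// ltn_expl.
Qed.

Lemma dyadic_scale (R : realType) (r : R) k0 : 0 < r -> r <= 2^-1 ^+ k0 ->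
  exists2 k, (k0 <= k)%N & 2^-1 ^+ k.+1 < r <= 2^-1 ^+ k.
Proof.
move=> r0 rk0.
have ex := exists_half_exp_lt r0.
have le_half i j : (i <= j)%N -> 2^-1 ^+ j <= 2^-1 ^+ i :> R.
  by move=> ij; rewrite ler_wiXn2l// invf_le1// ler1n.
case: (ex_minnP ex) => j jr jmin.
have k0j : (k0 < j)%N.
  by rewrite ltnNge; apply/negP => /le_half /(le_trans rk0); rewrite leNgt jr.
exists j.-1; first by rewrite -ltnS prednK// (leq_ltn_trans _ k0j).
rewrite prednK ?(leq_ltn_trans _ k0j)// jr/= leNgt; apply/negP => /jmin.
by rewrite leqNgt prednK ?leqnn// (leq_ltn_trans _ k0j).
Qed.

(** The Cauchy-Schwarz inequality, from the sum of the squares of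
    [k * q c - 1]. *)
Lemma sum_sqr_ge1 (R : realFieldType) k (q : 'I_k -> R) :
  \sum_c q c = 1 -> 1 <= k%:R * \sum_c q c ^+ 2.
Proof.
move=> q1.
have [k0|k0] := posnP k.
  by subst k; move: q1; rewrite big_ord0 => /esym/eqP; rewrite oner_eq0.
have : 0 <= \sum_c (k%:R * q c - 1) ^+ 2 by apply: sumr_ge0 => c _; exact: sqr_ge0.
have -> : \sum_c (k%:R * q c - 1) ^+ 2 =
    k%:R * (k%:R * \sum_c q c ^+ 2) - k%:R.
  under eq_bigr => c _.
    rewrite (_ : _ ^+ 2 = k%:R * (k%:R * q c ^+ 2) + (- k%:R * 2 * q c + 1)).
      over.
    by ring.
  rewrite !big_split/= -!mulr_sumr q1 sumr_const card_ord; ring.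
by rewrite subr_ge0 -[X in X <= _]mulr1 ler_pM2l// ltr0n.
Qed.

Section fbm.
Context d (T : measurableType d) (R : realType) (P : probability T R).
Context (n m : nat) (X : T -> 'rV[R]_n -> 'rV[R]_m) (alpha : R).
Hypotheses (alpha_gt0 : 0 < alpha).
Hypothesis X_fbm : fractional_brownian_motion P X alpha.
Implicit Types (x y : 'rV[R]_n) (r : R).

Local Notation coord := (Defs.coord X).

Definition close_coord (i : 'I_m) x y r : set T :=
  [set w | `|coord i x w - coord i y w| <= r].

(** Closeness for the sup norm of [R^m]: unlike its Euclidean analogue, which
    it contains, this event is an intersection of independent ones. *)
Definition close_images x y r : set T :=
  [set w | forall i, close_coord i x y r w].

Lemma close_coordE i x y r :
  close_coord i x y r = (fun w => coord i x w - coord i y w) @^-1` `[- r, r].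
Proof. by apply/seteqP; split=> w /=; rewrite /close_coord/= in_itv/= ler_norml. Qed.

Lemma close_imagesE x y r :
  close_images x y r = \bigcap_(i in [set` [set: 'I_m]%SET]) close_coord i x y r.
Proof.
apply/seteqP; split=> w wxy i; first by move=> _; exact: wxy.
by apply: wxy; rewrite /= inE.
Qed.

Lemma measurable_increment i x y :
  measurable_fun [set: T] (fun w => coord i x w - coord i y w).
Proof. by apply: measurable_funB; exact: fbm_measurable X_fbm _ _. Qed.

Lemma measurable_close_coord i x y r : measurable (close_coord i x y r).
Proof.
by rewrite close_coordE -[X in measurable X]setTI; exact: measurable_increment.
Qed.

Lemma measurable_close_images x y r : measurable (close_images x y r).
Proof.
rewrite close_imagesE; apply: fin_bigcap_measurable => [|i _].
  exact: finite_finset.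
exact: measurable_close_coord.
Qed.

(** Brings the event into the scope of the independence of the coordinates. *)
Lemma close_coord_sigma_algebra i x y r :
  coord_sigma_algebra X i (close_coord i x y r).
Proof.
rewrite close_coordE.
set G := [set S | exists (x : 'rV[R]_n) (B : set R),
                 measurable B /\ S = coord i x @^-1` B].
have mG z : measurable_fun [set: g_sigma_algebraType G] (coord i z).
  move=> _ B mB; rewrite setTI; apply: sub_sigma_algebra.
  by exists z, B.
have : measurable_fun [set: g_sigma_algebraType G]
    (fun w => coord i x w - coord i y w) by exact: measurable_funB.
move=> /(_ measurableT `[- r, r]%classic (measurable_itv _)).
by rewrite setTI.
Qed.

Lemma close_coord_prob i x y r : 0 < r ->
  (P (close_coord i x y r) <= (phi alpha (r `^ alpha^-1) (x - y))%:E)%E.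
Proof.
move=> r0; set rho := r `^ alpha^-1.
have rho0 : 0 < rho by rewrite powR_gt0.
have [le_rho|lt_rho] := leP (enorm (x - y)) rho.
  rewrite /phi max_l// divff ?gt_eqF// powR1; apply: probability_le1.
  exact: measurable_close_coord.
have e0 := lt_trans rho0 lt_rho.
have xy : x != y by rewrite -subr_eq0 -enorm_eq0 gt_eqF.
rewrite close_coordE (fbm_increment X_fbm) //.
have ea0 : 0 < enorm (x - y) `^ alpha by rewrite powR_gt0.
apply: (le_trans (normal_prob_centered_itv ea0 (ltW r0))).
rewrite lee_fin /phi max_r ?(ltW lt_rho)//.
rewrite (powR_div _ (ltW rho0) (ltW e0)) -powRrM mulVf ?gt_eqF//.
by rewrite powRr1 ?(ltW r0).
Qed.

Lemma close_images_prob x y r : 0 < r ->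
  (P (close_images x y r) <= (phi (m%:R * alpha) (r `^ alpha^-1) (x - y))%:E)%E.
Proof.
move=> r0; rewrite close_imagesE (fbm_independent X_fbm) => [|i _]; last first.
  exact: close_coord_sigma_algebra.
rewrite phi_exprE -[m in leRHS]card_ord -cardsT -prodr_const -prodEFin.
have fP i : (fine (P (close_coord i x y r)))%:E = P (close_coord i x y r).
  by rewrite fineK// fin_num_measure//; exact: measurable_close_coord.
under eq_bigr do rewrite -fP.
rewrite !prodEFin lee_fin; apply: ler_prod => i _.
by rewrite fine_ge0//= -lee_fin fP close_coord_prob.
Qed.

End fbm.

Lemma diameter_ler_coord (R : realType) n (U : set 'rV[R]_n) r u v (i : 'I_n) :
  (diameter U <= r%:E)%E -> U u -> U v -> `|u ord0 i - v ord0 i| <= r.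
Proof.
move=> Ur Uu Uv.
have := ler_coord_enorm (u - v) i; rewrite !mxE => /le_trans; apply.
rewrite -lee_fin; apply: le_trans Ur.
by apply: ereal_sup_ubound; exists (u, v).
Qed.

Section lower_bound.
Context d (T : measurableType d) (R : realType) (P : probability T R).
Context (n m : nat) (X : T -> 'rV[R]_n -> 'rV[R]_m) (alpha : R).
Hypotheses (n_gt0 : (0 < n)%N) (m_gt0 : (0 < m)%N).
Hypotheses (alpha_gt0 : 0 < alpha).
Hypothesis X_fbm : fractional_brownian_motion P X alpha.
Context (E : set 'rV[R]_n).
Hypotheses (E_compact : compact E) (E_neq0 : E !=set0).

Local Notation s := (m%:R * alpha).
Local Notation cap := (cap E s).

Let s_gt0 : 0 < s.
Proof. by rewrite mulr_gt0// ltr0n. Qed.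

(** As [coverable], but with diameters at most [r]: this relation is monotone
    in [r], so dyadic scales suffice. *)
Definition covered_within r (A : set 'rV[R]_m) (k : nat) : Prop :=
  exists U : 'I_k -> set 'rV[R]_m,
    (forall c, diameter (U c) <= r%:E)%E /\ A `<=` \bigcup_c U c.

Definition pair_count r (I : finType) (p : I -> R) (x : I -> 'rV[R]_n) w : R :=
  \sum_ij p ij.1 * p ij.2 *
    \1_(close_images X (x ij.1) (x ij.2) r) w.

(** Two points whose images lie in the same set of the cover form a close
    pair, and by the Cauchy-Schwarz inequality [k] sets cannot separate the
    points more than the uniform partition does. *)
Lemma pair_count_ge r (I : finType) (p : I -> R) (x : I -> 'rV[R]_n) w k :
  weights_in E p x -> covered_within r (X w @` E) k ->
  1 <= k%:R * pair_count r p x w.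
Proof.
move=> [p0 p1 Ex] [U [Ur XU]].
have /choice[a aP] i : exists c, U c (X w (x i)).
  by have [c _ Uc] := XU _ (imageP (X w) (Ex i)); exists c.
apply: (le_trans (sum_sqr_ge1 (q := fun c => \sum_(i | a i == c) p i) _)).
  by rewrite -p1 [RHS](partition_big a xpredT).
rewrite ler_wpM2l//.
have -> : \sum_c (\sum_(i | a i == c) p i) ^+ 2 =
    \sum_ij p ij.1 * p ij.2 * (a ij.1 == a ij.2)%:R.
  rewrite -(pair_bigA _ (fun i j => p i * p j * (a i == a j)%:R))/=.
  rewrite [RHS](partition_big a xpredT)//=; apply: eq_bigr => c _.
  rewrite expr2 mulr_suml; apply: eq_bigr => i /eqP aic.
  rewrite mulr_sumr [LHS]big_mkcond; apply: eq_bigr => j _.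
  by rewrite aic eq_sym; case: eqP => _; rewrite ?mulr1 ?mulr0.
apply: ler_sum => -[i j] _ /=; rewrite ler_wpM2l ?mulr_ge0//.
have [aij|_] := eqVneq; last by rewrite /=.
rewrite indicE mem_set// => l.
by apply: (diameter_ler_coord l (Ur (a i))) => //; rewrite aij.
Qed.

Lemma integral_pair_count r (I : finType) (p : I -> R)
    (x : I -> 'rV[R]_n) : 0 < r ->
  weights_in E p x ->
  (\int[P]_w (pair_count r p x w)%:E <=
   (finite_energy s (r `^ alpha^-1) p x)%:E)%E.
Proof.
move=> r0 [p0 p1 Ex].
rewrite integral_sum_indic => [|ij|ij]; last 2 first.
- by rewrite mulr_ge0.
- exact: (measurable_close_images X_fbm).
rewrite /finite_energy pair_bigA/= -sumEFin; apply: lee_sum => -[i j] _ /=.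
rewrite [leRHS]EFinM; apply: lee_wpmul2l; first by rewrite lee_fin mulr_ge0.
exact: close_images_prob.
Qed.

Lemma measurable_pair_count r (I : finType) (p : I -> R) (x : I -> 'rV[R]_n) :
  measurable_fun [set: T] (pair_count r p x).
Proof.
apply: measurable_sum => ij; apply: measurable_funM => //.
by apply: measurable_indic; exact: (measurable_close_images X_fbm).
Qed.

Lemma pair_count_ge0 r (I : finType) (p : I -> R) (x : I -> 'rV[R]_n) w :
  weights_in E p x -> 0 <= pair_count r p x w.
Proof. by move=> [p0 _ _]; apply: sumr_ge0 => ij _; rewrite !mulr_ge0. Qed.

Let K := 2 * (Num.sqrt n%:R * 3) `^ s : R.

(** Markov's inequality for [pair_count] and weights of nearly minimal
    energy. *)
Lemma few_covers_improbable r t : 0 < r -> 0 < t ->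
  exists F : set T, [/\ measurable F, (P F <= (t^-1)%:E)%E &
    forall w k, ~ F w -> covered_within r (X w @` E) k ->
      cap (r `^ alpha^-1) <= K * t * k%:R].
Proof.
move=> r0 t0; set rho := r `^ alpha^-1.
have rho0 : 0 < rho by rewrite powR_gt0.
have [I [p [x [wx capx]]]] :=
  cap_near_minimizer n_gt0 s_gt0 E_compact E_neq0 rho0.
have c0 := cap_gt0 n_gt0 s_gt0 E_compact E_neq0 rho0.
have capx1 := cap_finite_energy_ge1 n_gt0 s_gt0 E_compact E_neq0 rho0 wx.
have intS := integral_pair_count r0 wx.
move: capx capx1 intS; rewrite -/K -/rho.
set e := finite_energy _ _ _ _ => capx capx1 intS.
have e0 : 0 < e by rewrite -(pmulr_rgt0 _ c0) (lt_le_trans ltr01).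
pose F := [set w | t * e <= pair_count r p x w].
have mF : measurable F.
  have := measurable_pair_count r p x.
  move=> /(_ measurableT `[t * e, +oo[%classic (measurable_itv _)).
  rewrite setTI; congr measurable; apply/seteqP; split=> w /=; rewrite in_itv/= andbT//.
exists F; split=> //.
  rewrite -(@lee_pmul2l _ (t * e)%:E)// ?lte_fin ?mulr_gt0//.
  have te : t * e * t^-1 = e by field; rewrite gt_eqF.
  rewrite -EFinM te.
  apply: le_trans intS.
  have -> : ((t * e)%:E * P F =
      \int[P]_w (\sum_(i < 1) t * e * \1_F w)%:E)%E.
    rewrite (integral_sum_indic P (c := fun=> t * e) (Q := fun=> F))//.
      by rewrite big_ord1.
    by move=> _; rewrite mulr_ge0// ltW.
  apply: ge0_le_integral_nonmeasurable => w; rewrite big_ord1 lee_fin.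
    by rewrite mulr_ge0// mulr_ge0// ltW.
  rewrite indicE; have [/[!inE]//|_] := boolP (w \in F).
    by rewrite mulr1.
  by rewrite mulr0; exact: pair_count_ge0.
move=> w k /negP; rewrite -ltNge => Sw wk.
have := pair_count_ge wx wk => kS.
have k1 : 1 <= k%:R * (t * e).
  by apply: (le_trans kS); rewrite ler_wpM2l// ltW.
apply: (@le_trans _ _ (cap rho * (k%:R * (t * e)))).
  by apply: ler_peMr => //; exact: ltW.
rewrite [leLHS](_ : _ = cap rho * e * (t * k%:R)); last by ring.
by rewrite -[leRHS]mulrA ler_wpM2r// mulr_ge0// ltW.
Qed.

(** Borel-Cantelli along the scales [2^-k], with
    [t = 2^(k * eps)]; the other scales are compared with dyadic ones. *)
Lemma ae_cap_le_covering eps : 0 < eps ->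
  {ae P, forall w, exists2 L, 0 < L & \forall r \near 0^'+,
     forall k, covered_within r (X w @` E) k ->
       cap (r `^ alpha^-1) * r `^ eps <= L * k%:R}.
Proof.
move=> eps0; set h := 2^-1 : R.
have h0 : 0 < h by rewrite invr_gt0.
have h1 : h < 1 by rewrite invf_lt1// ltr1n.
pose q := h `^ eps.
have q0 : 0 < q by rewrite powR_gt0.
have q1 : q < 1 by apply: powR_lt1 => //; exact: ltW.
have /choice[F FP] k : exists F : set T, [/\ measurable F,
    (P F <= (1 * q ^+ k)%:E)%E &
    forall w N, ~ F w -> covered_within (h ^+ k) (X w @` E) N ->
      cap ((h ^+ k) `^ alpha^-1) <= K * (q ^+ k)^-1 * N%:R].
  have := @few_covers_improbable (h ^+ k) (q ^+ k)^-1.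
  by rewrite invrK mul1r; apply; rewrite ?invr_gt0 exprn_gt0.
have : {ae P, forall w, exists k0, forall k, (k0 <= k)%N -> ~ F k w}.
  apply: (ae_eventually_not (C := 1) (q := q)) => //.
  - by rewrite ltW.
  - by move=> k; have [] := FP k.
  - by move=> k; have [] := FP k.
apply: filterS => w [k0 k0F].
have K0 : 0 < K.
  by rewrite mulr_gt0// powR_gt0// mulr_gt0// sqrtr_gt0 ltr0n.
pose c := ((2 : R) `^ alpha^-1) `^ s.
have c0 : 0 < c by rewrite !powR_gt0.
exists (K * c * K); first exact: mulr_gt0 (mulr_gt0 K0 c0) K0.
near=> r => N XN.
have r0 : 0 < r by near: r; exact: nbhs_right_gt.
have rk0 : r <= h ^+ k0.
  by near: r; apply: nbhs_right_le; rewrite exprn_gt0.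
have [k k0k /andP[kr rk]] := dyadic_scale r0 rk0.
have [_ _ /(_ w N (k0F _ k0k))] := FP k.
have XNk : covered_within (h ^+ k) (X w @` E) N.
  have [U [Ur XU]] := XN; exists U; split=> // i.
  by apply: (le_trans (Ur i)); rewrite lee_fin.
move=> /(_ XNk) capk.
have a0 : 0 <= alpha^-1 by rewrite invr_ge0 ltW.
have rho0 : 0 < r `^ alpha^-1 by rewrite powR_gt0.
have rhok : r `^ alpha^-1 <= (h ^+ k) `^ alpha^-1.
  by apply: ler_powR2r => //; exact: ltW.
have scale := cap_scale n_gt0 s_gt0 E_compact E_neq0 rho0 rhok.
have ratio : ((h ^+ k) `^ alpha^-1 / r `^ alpha^-1) `^ s <= c.
  apply: ler_powR2r; [exact: ltW|by rewrite divr_ge0// powR_ge0|].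
  rewrite ler_pdivrMr// -powRM ?(ltW r0)//; apply: ler_powR2r => //.
    by rewrite exprn_ge0// ltW.
  move: kr; rewrite exprS -/h => /ltW.
  by rewrite -(@ler_pM2l _ 2)// mulrA divff// mul1r.
have rq : r `^ eps <= q ^+ k.
  apply: (@le_trans _ _ ((h ^+ k) `^ eps)).
    by apply: ler_powR2r; [exact: ltW|exact: ltW|].
  by rewrite powR_exprn// ltW.
have qk0 : 0 < q ^+ k by rewrite exprn_gt0.
have capk0 := cap_gt0 n_gt0 s_gt0 E_compact E_neq0 (powR_gt0 alpha^-1 (exprn_gt0 k h0)).
have cap0 := cap_gt0 n_gt0 s_gt0 E_compact E_neq0 rho0.
move: scale capk capk0 cap0 ratio rq; rewrite -/K.
move: (cap _) (cap _) (_ `^ s) (r `^ eps) => c2 c1 u v.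
move=> c1c2 c2N c20 c10 uc vq.
apply: (@le_trans _ _ (K * c * c2 * q ^+ k)).
  apply: (@le_trans _ _ (c1 * q ^+ k)); first by rewrite ler_wpM2l// ltW.
  rewrite ler_wpM2r ?(ltW qk0)//; apply: (le_trans c1c2).
  by rewrite ler_wpM2r ?(ltW c20)// ler_wpM2l// ltW.
rewrite -[leLHS]mulrA -[leRHS]mulrA; apply: ler_wpM2l.
  by rewrite mulr_ge0// ltW.
by rewrite -ler_pdivlMr// mulrAC.
Unshelve. all: by end_near. Qed.

End lower_bound.

(** * Modulus of continuity *)

Section dyadic_grid.
Context (R : realType) (n : nat).
Local Notation h := (2^-1 : R).

Let h_gt0 : 0 < h. Proof. by rewrite invr_gt0. Qed.
Let hX_gt0 k : 0 < h ^+ k. Proof. by rewrite exprn_gt0. Qed.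

Definition grid_index (N k : nat) : finType :=
  {ffun 'I_n -> 'I_(Num.truncn (N.*2%:R / h ^+ k)).+1}.

Definition grid_point N k (a : grid_index N k) : 'rV[R]_n :=
  \row_l ((a l)%:R * h ^+ k - N%:R).
Arguments grid_point : clear implicits.

Definition dyadic_approx N k (x : 'rV[R]_n) : 'rV[R]_n :=
  grid_point N k (cell N (h ^+ k) x).

Lemma dyadic_approx_dist N k (x : 'rV[R]_n) : `|x| <= N%:R ->
  `|x - dyadic_approx N k x| <= h ^+ k.
Proof.
move=> xN; apply: ler_norm_coord => [|l]; first exact: ltW.
have /andP[] := cell_itv l (hX_gt0 k) xN.
rewrite !mxE -[(cell _ _ _ _).+1%:R]natr1 mulrDl mul1r => ? ?.
by rewrite ger0_norm; lra.
Qed.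

(** The points of two consecutive levels together, so that one family of
    increments contains both the links from one level to the next and those
    between neighbours of the same level. *)
Definition grid_pair_point N k
    (v : (grid_index N k + grid_index N k.+1)%type) : 'rV[R]_n :=
  match v with inl a => grid_point N k a | inr b => grid_point N k.+1 b end.
Arguments grid_pair_point : clear implicits.

Lemma card_grid_index N k :
  #|grid_index N k|%:R <= ((N.*2.+1)%:R * 2 ^+ k) ^+ n :> R.
Proof.
rewrite card_ffun !card_ord natrX lerXn2r ?nnegrE ?mulr_ge0 ?exprn_ge0//.
rewrite -[leLHS]natr1 -[in leRHS]natr1 mulrDl mul1r; apply: lerD; last first.
  by rewrite exprn_ege1// ler1n.
have : (Num.truncn (N.*2%:R / h ^+ k))%:R <= N.*2%:R / h ^+ k.
  by rewrite truncn_le divr_ge0// ltW.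
by rewrite exprVn invrK.
Qed.

Lemma card_grid_pair N k :
  #|{: grid_index N k + grid_index N k.+1}|%:R <=
    (2 * ((N.*2.+1)%:R * 2) ^+ n) * (2 ^+ n) ^+ k :> R.
Proof.
rewrite card_sum natrD.
have -> : 2 * ((N.*2.+1)%:R * 2) ^+ n * (2 ^+ n) ^+ k =
    ((N.*2.+1)%:R * 2 ^+ k.+1) ^+ n + ((N.*2.+1)%:R * 2 ^+ k.+1) ^+ n :> R.
  rewrite -mulr2n -[RHS]mulr_natl -[LHS]mulrA; congr (_ * _).
  by rewrite -exprM mulnC exprM -exprMn exprS mulrA.
apply: lerD; last exact: card_grid_index.
apply: (le_trans (card_grid_index _ _)).
rewrite lerXn2r ?nnegrE ?mulr_ge0 ?exprn_ge0// ler_wpM2l//.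
by rewrite ler_weXn2l// ler1n.
Qed.

Section chaining.
Context (N k0 : nat) (theta : R) (f : 'rV[R]_n -> R).
Hypotheses (theta_gt0 : 0 < theta) (theta_lt1 : theta < 1).
Hypothesis f_cont : continuous f.
Hypothesis f_grid : forall k, (k0 <= k)%N -> forall u v,
  `|grid_pair_point N k u - grid_pair_point N k v| <= 3 * h ^+ k ->
  `|f (grid_pair_point N k u) - f (grid_pair_point N k v)| <= theta ^+ k.

Let chain_step k x : (k0 <= k)%N -> `|x| <= N%:R ->
  `|f (dyadic_approx N k x) - f (dyadic_approx N k.+1 x)| <= theta ^+ k.
Proof.
move=> k0k xN.
apply: (@f_grid k k0k (inl (cell N (h ^+ k) x))
  (inr (cell N (h ^+ k.+1) x))) => /=.
rewrite -/(dyadic_approx N k x) -/(dyadic_approx N k.+1 x).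
rewrite -(subrKA x); apply: (le_trans (ler_normD _ _)).
rewrite distrC.
have := dyadic_approx_dist k xN; have := dyadic_approx_dist k.+1 xN.
have : h ^+ k.+1 <= h ^+ k.
  by rewrite exprS; apply: ler_piMl; [exact: ltW|rewrite invf_le1// ler1n].
have := hX_gt0 k; lra.
Qed.

Let chain k j x : (k0 <= k)%N -> `|x| <= N%:R ->
  `|f (dyadic_approx N k x) - f (dyadic_approx N (k + j) x)| * (1 - theta)
    <= theta ^+ k - theta ^+ (k + j).
Proof.
move=> k0k xN; elim: j => [|j IH]; first by rewrite addn0 !subrr normr0 mul0r.
have t1 : 0 < 1 - theta by rewrite subr_gt0.
have step := chain_step (leq_trans k0k (leq_addr j k)) xN.
rewrite addnS -(subrKA (f (dyadic_approx N (k + j) x))).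
apply: (@le_trans _ _ ((`|f (dyadic_approx N k x) - f (dyadic_approx N (k + j) x)| +
   theta ^+ (k + j)) * (1 - theta))).
  rewrite ler_pM2r//; apply: (le_trans (ler_normD _ _)).
  by rewrite lerD2l.
by rewrite mulrDl exprS; lra.
Qed.

(** Summing the geometric series of the links, then using continuity at
    [x]. *)
Let chain_limit k x : (k0 <= k)%N -> `|x| <= N%:R ->
  `|f (dyadic_approx N k x) - f x| <= theta ^+ k / (1 - theta).
Proof.
move=> k0k xN; have t1 : 0 < 1 - theta by rewrite subr_gt0.
apply/ler_addgt0Pr => e e0.
have /cvgrPdist_le/(_ _ e0) := @f_cont x.
move=> /nbhs_normP[delta /= delta0 near_x].
have [j jdelta] := exists_half_exp_lt delta0.
have close_x : `|f x - f (dyadic_approx N (k + j) x)| <= e.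
  apply: near_x => /=; apply: (le_lt_trans (dyadic_approx_dist _ xN)).
  apply: le_lt_trans jdelta; rewrite ler_wiXn2l ?leq_addl// ?ltW//.
  by rewrite invf_lt1// ltr1n.
have := chain j k0k xN; rewrite -ler_pdivlMr// => chainj.
rewrite -(subrKA (f (dyadic_approx N (k + j) x))).
apply: (le_trans (ler_normD _ _)); rewrite [X in _ + X <= _]distrC.
apply: lerD => //; apply: (le_trans chainj).
by rewrite ler_pM2r ?invr_gt0// gerBl exprn_ge0// ltW.
Qed.

(** Kolmogorov's chaining: [x] and [y] are joined through their dyadic
    approximations at level [k]. *)
Lemma chaining_bound k x y : (k0 <= k)%N -> `|x| <= N%:R -> `|y| <= N%:R ->
  `|x - y| <= h ^+ k ->
  `|f x - f y| <= (1 + 2 / (1 - theta)) * theta ^+ k.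
Proof.
move=> k0k xN yN xy.
have fxy : `|f (dyadic_approx N k x) - f (dyadic_approx N k y)| <= theta ^+ k.
  apply: (@f_grid k k0k (inl (cell N (h ^+ k) x))
    (inl (cell N (h ^+ k) y))) => /=.
  rewrite -/(dyadic_approx N k x) -/(dyadic_approx N k y).
  apply: (le_trans (ler_distD x _ _)); rewrite distrC.
  have := dyadic_approx_dist k xN; have := dyadic_approx_dist k yN.
  have := ler_distD y x (dyadic_approx N k y); lra.
have := chain_limit k0k xN; have := chain_limit k0k yN.
move=> chy chx.
apply: (le_trans (ler_distD (f (dyadic_approx N k x)) _ _)).
rewrite [X in X + _]distrC.
have := ler_distD (f (dyadic_approx N k y)) (f (dyadic_approx N k x)) (f y).
rewrite mulrDl mul1r -mulrA [(_ - _)^-1 * _]mulrC; lra.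
Qed.

End chaining.

End dyadic_grid.
Arguments grid_pair_point {R n} N k v.

Lemma le_measure_bigsetU d (T : measurableType d) (R : realType)
    (mu : {measure set T -> \bar R}) (I : Type) (s : seq I) (p : pred I)
    (F : I -> set T) : (forall i, measurable (F i)) ->
  (mu (\big[setU/set0]_(i <- s | p i) F i) <= \sum_(i <- s | p i) mu (F i))%E.
Proof.
move=> mF; elim: s => [|i s IH]; first by rewrite !big_nil measure0.
rewrite !big_cons; case: ifP => // _.
apply: (le_trans (measureU2 _ (mF i) _)).
  by apply: bigsetU_measurable => j _; exact: mF.
exact: leeD2l.
Qed.

Section holder.
Context d (T : measurableType d) (R : realType) (P : probability T R).
Context (n m : nat) (X : T -> 'rV[R]_n -> 'rV[R]_m) (alpha : R).
Hypotheses (alpha_gt0 : 0 < alpha).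
Hypothesis X_fbm : fractional_brownian_motion P X alpha.

Local Notation coord := (Defs.coord X).

Lemma far_coord_prob (q : nat) : exists2 C : R, 0 < C &
  forall i x y a delta, 0 < a -> 0 < delta -> enorm (x - y) <= delta ->
    (P (~` close_coord X i x y a) <=
      (C * (delta `^ alpha / a) ^+ (2 * q.+1))%:E)%E.
Proof.
have [C C0 tail] := normal_prob_tail_poly R q.
exists C => // i x y a delta a0 delta0 xy_delta.
have [->|xy] := eqVneq x y.
  rewrite (_ : ~` _ = set0).
    by rewrite measure0 lee_fin mulr_ge0 ?exprn_ge0 ?divr_ge0 ?powR_ge0// ltW.
  rewrite -subset0 => w /=; apply; rewrite /close_coord/= subrr normr0.
  exact: ltW.
have e0 : 0 < enorm (x - y).
  by rewrite lt_neqAle enorm_ge0 eq_sym enorm_eq0 subr_eq0 xy.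
have ea0 : 0 < enorm (x - y) `^ alpha by rewrite powR_gt0.
have -> : ~` close_coord X i x y a =
    (fun w => coord i x w - coord i y w) @^-1` (~` `[- a, a]).
  by rewrite close_coordE.
rewrite (fbm_increment X_fbm)//; last exact: measurableC.
apply: (le_trans (tail _ _ ea0 a0)); rewrite lee_fin ler_wpM2l ?(ltW C0)//.
rewrite lerXn2r ?nnegrE ?divr_ge0 ?powR_ge0 ?(ltW a0)//.
rewrite ler_pM2r ?invr_gt0//; apply: ler_powR2r => //; first exact: ltW.
exact: enorm_ge0.
Qed.

(** Union bound over the coordinates and over the pairs of points at distance
    at most [delta]. *)
Lemma large_increments_improbable (q : nat) : exists2 C : R, 0 < C &
  forall (V : finType) (g : V -> 'rV[R]_n) a delta, 0 < a -> 0 < delta ->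
    exists F : set T, [/\ measurable F,
      (P F <= (C * #|V|%:R ^+ 2 *
         ((Num.sqrt n%:R * delta) `^ alpha / a) ^+ (2 * q.+1))%:E)%E &
      forall w, ~ F w -> forall i u v, `|g u - g v| <= delta ->
        `|coord i (g u) w - coord i (g v) w| <= a].
Proof.
have [C C0 tail] := far_coord_prob q.
exists (m.+1%:R * C); first exact: mulr_gt0.
move=> V g a delta a0 delta0.
pose S (t : 'I_m * (V * V)) := close_coord X t.1 (g t.2.1) (g t.2.2) a.
pose p (t : 'I_m * (V * V)) := `|g t.2.1 - g t.2.2| <= delta.
have mS t : measurable (~` S t).
  by apply: measurableC; exact: (measurable_close_coord X_fbm).
exists (\big[setU/set0]_(t | p t) ~` S t); split.
- by apply: bigsetU_measurable => t _; exact: mS.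
- apply: (le_trans (le_measure_bigsetU _ _ _ mS)).
  set B := _ ^+ (2 * q.+1).
  have B0 : 0 <= B.
    by rewrite exprn_ge0// divr_ge0 ?powR_ge0// ltW.
  apply: (@le_trans _ _ (\sum_(t : 'I_m * (V * V)) (C * B)%:E)%E).
    rewrite big_mkcond/=; apply: lee_sum => -[i [u v]] _.
    have CB0 : 0 <= C * B by rewrite mulr_ge0// ltW.
    case: ifPn => [uv|_]; last by rewrite lee_fin.
    have [n0|n0] := posnP n.
      rewrite (_ : ~` _ = set0); first by rewrite measure0 lee_fin.
      rewrite -subset0 => w /=; apply; rewrite /S /close_coord/=.
      have -> : g u = g v.
        apply/rowP => j; exfalso.
        by move: (leq_ltn_trans (leq0n j) (ltn_ord j)); rewrite n0.
      by rewrite subrr normr0 ltW.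
    apply: tail => //; first by rewrite mulr_gt0// sqrtr_gt0 ltr0n.
    by apply: (le_trans (ler_enorm_norm _)); rewrite ler_wpM2l// sqrtr_ge0.
  rewrite sumEFin lee_fin sumr_const !card_prod card_ord -[leLHS]mulr_natl.
  rewrite !natrM -expr2 [leLHS](_ : _ = m%:R * (C * #|V|%:R ^+ 2 * B)).
    rewrite -!mulrA ler_wpM2r ?ler_nat//.
    by rewrite !mulr_ge0 ?(ltW C0).
  by ring.
- move=> w nFw i u v uv; apply: contrapT => far; apply: nFw.
  by rewrite (bigD1 (i, (u, v)))//=; left.
Qed.

(** Almost sure Hoelder continuity on [E] of every exponent [beta < alpha]. The
    distance is replaced by its maximum with an arbitrary [rho > 0], which is
    the form in which it enters the kernel. At level [k] of the grid the number
    of pairs grows like [(2^n)^(2k)], while the probability of a large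
    increment decays like [(2^-(alpha - beta))^(2(q+1)k)]; [q] is chosen so
    that the decay wins. *)
Lemma ae_increment_bound (beta : R) (E : set 'rV[R]_n) :
  (0 < n)%N -> 0 < beta -> beta < alpha -> compact E ->
  {ae P, forall w, exists2 K, 0 < K & forall rho x y i, 0 < rho ->
    E x -> E y ->
    `|X w x ord0 i - X w y ord0 i| <= K * Num.max rho (enorm (x - y)) `^ beta}.
Proof.
move=> n0 beta0 beta_alpha cE; set h := 2^-1 : R.
have h0 : 0 < h by rewrite invr_gt0.
have h1 : h < 1 by rewrite invf_lt1// ltr1n.
have h_lt1 z : 0 < z -> h `^ z < 1.
  by move=> z0; apply: powR_lt1 => //; exact: ltW.
pose theta := h `^ beta; pose gam := h `^ (alpha - beta).
have theta0 : 0 < theta by rewrite powR_gt0.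
have theta1 : theta < 1 by exact: h_lt1.
have gam0 : 0 < gam by rewrite powR_gt0.
have gam1 : gam < 1 by apply: h_lt1; rewrite subr_gt0.
have alphaE : h `^ alpha / theta = gam.
  by rewrite -powRN -powRD; [|apply/implyP => _; rewrite gt_eqF].
have hX0 k : 0 < h ^+ k by rewrite exprn_gt0.
have powRX z k : (h ^+ k) `^ z = (h `^ z) ^+ k.
  by apply: powR_exprn; exact: ltW.
have [q gamq] : exists q, gam ^+ q.+1 < h ^+ n.
  have : gam ^+ j @[j --> \oo] --> (0 : R).
    by apply: cvg_expr; rewrite gtr0_norm.
  move=> /cvgrPdist_lt/(_ _ (hX0 n))[j _ /(_ j.+1 (leqnSn j))].
  rewrite sub0r normrN gtr0_norm ?exprn_gt0// => ?.
  by exists j.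
have [C C0 bad] := large_increments_improbable q.
have [N EN] := compact_norm_le_nat cE.
have th0 k : 0 < theta ^+ k by rewrite exprn_gt0.
have h30 k : 0 < 3 * h ^+ k by rewrite mulr_gt0.
have /choice[F FP] k := bad _ (grid_pair_point N k) _ _ (th0 k) (h30 k).
pose D : R := 2 * ((N.*2.+1)%:R * 2) ^+ n.
pose A : R := (Num.sqrt n%:R * 3) `^ alpha.
have D0 : 0 <= D by rewrite mulr_ge0// exprn_ge0// mulr_ge0.
have A0 : 0 <= A by exact: powR_ge0.
pose lambda := (2 ^+ n * gam ^+ q.+1) ^+ 2.
have l0 : 0 <= 2 ^+ n * gam ^+ q.+1.
  by rewrite mulr_ge0 ?exprn_ge0// ltW.
have good : {ae P, forall w, exists k0, forall k, (k0 <= k)%N -> ~ F k w}.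
  apply: (ae_eventually_not (C := C * D ^+ 2 * A ^+ (2 * q.+1))
    (q := lambda)) => [|||k].
  - by rewrite !mulr_ge0 ?exprn_ge0// ltW.
  - rewrite exprn_ge0//=; apply: exprn_ilt1 => //.
    by rewrite -ltr_pdivlMl ?exprn_gt0// mulr1 -exprVn.
  - by move=> k; have [] := FP k.
  have [_ /le_trans + _] := FP k; apply; rewrite lee_fin.
  have -> : (Num.sqrt n%:R * (3 * h ^+ k)) `^ alpha / theta ^+ k =
      A * gam ^+ k.
    rewrite mulrA powRM ?mulr_ge0 ?sqrtr_ge0 ?(ltW (hX0 k))//.
    by rewrite powRX -mulrA -expr_div_n alphaE.
  have V0 : 0 <= #|{: grid_index R n N k + grid_index R n N k.+1}|%:R :> R by [].
  have := card_grid_pair R n N k; rewrite -/D => cardV.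
  rewrite (_ : _ * lambda ^+ k = C * (D * (2 ^+ n) ^+ k) ^+ 2 *
     (A * gam ^+ k) ^+ (2 * q.+1)).
    rewrite ler_wpM2r ?exprn_ge0 ?mulr_ge0 ?exprn_ge0 ?(ltW gam0)//.
    by rewrite ler_wpM2l ?(ltW C0)// lerXn2r// nnegrE mulr_ge0// exprn_ge0// exprn_ge0.
  rewrite /lambda [(A * _) ^+ _]exprMn [(D * _) ^+ _]exprMn.
  have -> : ((2 ^+ n * gam ^+ q.+1) ^+ 2) ^+ k =
      ((2 ^+ n) ^+ k) ^+ 2 * (gam ^+ k) ^+ (2 * q.+1) :> R.
    move: (2 ^+ n) => a; rewrite !exprMn -!exprM.
    by rewrite mulrACA -!exprD; congr (_ ^+ _ * _ ^+ _); ring.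
  by ring.
apply: filterS2 (fbm_continuous X_fbm) good => w [Xw_cont _] [k0 k0F].
have coord_cont i : continuous (fun x => X w x ord0 i).
  move=> x; apply: (@continuous_comp _ _ _ (X w) (fun y : 'rV[R]_m => y ord0 i)).
    exact: Xw_cont.
  exact: coord_continuous.
have [B XB] : exists B : nat, forall x, E x -> `|X w x| <= B%:R.
  have [|B XB] := @compact_norm_le_nat _ _ (X w @` E).
    by apply: continuous_compact => //; exact: continuous_subspaceT.
  by exists B => x Ex; apply: XB; exists x.
pose c := 1 + 2 / (1 - theta).
have c0 : 0 < c by rewrite addr_gt0// divr_gt0// subr_gt0.
pose K1 := c * 2 `^ beta.
pose K2 := 2 * B%:R / (h ^+ k0) `^ beta.
have K10 : 0 < K1 by rewrite mulr_gt0// powR_gt0.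
have K20 : 0 <= K2 by rewrite divr_ge0 ?mulr_ge0// powR_ge0.
exists (K1 + K2); first exact: ltr_wpDr.
move=> rho x y i rho0 Ex Ey; set t := Num.max _ _.
have t0 : 0 < t by rewrite lt_max rho0.
(* At small distances chaining applies; at large ones the path is bounded. *)
have [tk0|k0t] := leP t (h ^+ k0).
  have [k k0k /andP[kt tk]] := dyadic_scale t0 tk0.
  have f_grid j : (k0 <= j)%N -> forall u v,
      `|grid_pair_point N j u - grid_pair_point N j v| <= 3 * h ^+ j ->
      `|X w (grid_pair_point N j u) ord0 i -
        X w (grid_pair_point N j v) ord0 i| <= theta ^+ j.
    by move=> k0j u v uv; have [_ _ /(_ w (k0F _ k0j) i u v uv)] := FP j.
  have xyk : `|x - y| <= h ^+ k.
    apply: le_trans tk; apply: (le_trans (ler_norm_enorm _)).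
    by rewrite le_max lexx orbT.
  have := chaining_bound theta0 theta1 (coord_cont i) f_grid k0k (EN _ Ex) (EN _ Ey) xyk.
  move=> /le_trans; apply; rewrite -/c.
  apply: (@le_trans _ _ (K1 * t `^ beta)); last first.
    by rewrite ler_wpM2r ?powR_ge0// lerDl.
  rewrite /K1 -mulrA -powRM ?(ltW t0)// ler_wpM2l ?(ltW c0)// -powRX.
  apply: ler_powR2r; [exact: ltW|exact: ltW|].
  move: kt; rewrite exprS -/h => /ltW.
  by rewrite -(@ler_pM2l _ 2)// mulrA divff// mul1r.
apply: (@le_trans _ _ (K2 * t `^ beta)); last first.
  by rewrite ler_wpM2r ?powR_ge0// lerDr ltW.
apply: (@le_trans _ _ (2 * B%:R)).
  have hB z : E z -> `|X w z ord0 i| <= B%:R.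
    by move=> /XB; apply: le_trans; exact: ler_coord_norm.
  rewrite mulr_natl mulr2n; apply: (le_trans (ler_normB _ _)).
  by apply: lerD; exact: hB.
rewrite /K2 -mulrA ler_peMr ?mulr_ge0//.
rewrite mulrC ler_pdivlMr ?powR_gt0// mul1r.
by apply: ler_powR2r; [exact: ltW|exact: ltW|exact: ltW].
Qed.

End holder.

(** * Upper bound for covering numbers *)

Section harmonic.
Context (R : realType).

Definition harmonic_sum (L : nat) : R := \sum_(0 <= j < L) j.+1%:R^-1.

Lemma harmonic_sum_mono a b : (a <= b)%N -> harmonic_sum a <= harmonic_sum b.
Proof.
move=> ab; rewrite /harmonic_sum (big_cat_nat (leq0n a) ab)//= lerDl.
by apply: sumr_ge0 => j _; rewrite invr_ge0.
Qed.

Lemma harmonic_sum_ln L : harmonic_sum L.+1 <= 1 + ln L.+1%:R.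
Proof.
elim: L => [|L IH].
  by rewrite /harmonic_sum big_nat1 invr1 ln1 addr0.
rewrite /harmonic_sum big_nat_recr//=.
have step : L.+2%:R^-1 <= ln L.+2%:R - ln L.+1%:R :> R.
  have x1 : -1 < - L.+2%:R^-1 :> R by rewrite ltrN2 invf_lt1// ltr1n.
  have := le_ln1Dx x1.
  have -> : 1 + - L.+2%:R^-1 = L.+1%:R / L.+2%:R :> R.
    by rewrite -[in RHS](addrK 1 L.+1%:R) natr1 mulrBl divff// mul1r.
  rewrite ln_div ?posrE//; move: (ln _) (ln _) (_^-1) => u v x; lra.
move: IH step; rewrite /harmonic_sum.
by move: (ln _) (ln _) (\sum_(_ <= _ < _) _) (_^-1) => a b c e ? ?; lra.
Qed.

(** Each distance to [b] is attained at most twice. *)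
Lemma sum_inv_dist_le (L b : nat) : (b < L)%N ->
  \sum_(t < L) (`|t%:R - b%:R| + 1)^-1 <= 2 * harmonic_sum L :> R.
Proof.
move=> bL.
rewrite -(big_mkord xpredT (fun t => (`|t%:R - b%:R| + 1)^-1)).
rewrite (big_cat_nat (leq0n b) (ltnW bL))//= mulr2n mulrDl mul1r.
apply: lerD.
  apply: le_trans (harmonic_sum_mono (ltnW bL)).
  rewrite big_nat_rev/= add0n; apply: ler_sum_nat => t /andP[_ tb].
  rewrite distrC -natrB ?leq_subr// subKn// ger0_norm// natr1.
  by rewrite lef_pV2 ?posrE// ler_nat.
rewrite -{1}[b]add0n big_addn.
apply: le_trans (harmonic_sum_mono (leq_subr b L)).
apply: ler_sum_nat => t _.
by rewrite natrD addrK ger0_norm// natr1.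
Qed.

End harmonic.

Section covering.
Context (R : realType) (m : nat).
Implicit Types (r : R) (A : set 'rV[R]_m).

(** Any cover by sets of diameter [r] makes the default value in the definition
    of [covering_number] irrelevant. *)
Lemma covering_numberP r A k : coverable r A k ->
  coverable r A (covering_number r A) /\ (covering_number r A <= k)%N.
Proof.
move=> kA; pose cov := fun j => `[< coverable r A j >].
have ex : exists j, cov j by exists k; exact/asboolP.
have : exists j, [set j | coverable r A j /\
    forall i, coverable r A i -> (j <= i)%N] j.
  case: (ex_minnP ex) => j /asboolP jA jmin; exists j; split=> // i iA.
  by apply: jmin; exact/asboolP.
move=> /(xgetPex 0%N); rewrite -/(covering_number r A) => -[? min].
by split=> //; exact: min.
Qed.

(** The closure of a cell: its diameter is attained at opposite corners. *)
Definition grid_cube N eta (a : 'I_m -> nat) : set 'rV[R]_m :=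
  [set z | forall l,
    (a l)%:R * eta - N%:R <= z ord0 l <= (a l).+1%:R * eta - N%:R].

Lemma diameter_grid_cube (N : nat) eta a : 0 < eta ->
  diameter (grid_cube N eta a) = (Num.sqrt m%:R * eta)%:E.
Proof.
move=> eta0; apply/eqP; rewrite eq_le; apply/andP; split.
  apply: ge_ereal_sup => _ [[u v] [/= ua va] <-].
  rewrite lee_fin; apply: (le_trans (ler_enorm_norm _)).
  rewrite ler_wpM2l ?sqrtr_ge0//; apply: ler_norm_coord => [|l].
    exact: ltW.
  have := ua l; have := va l; rewrite !mxE -natr1 mulrDl mul1r ler_norml.
  move=> /andP[? ?] /andP[? ?]; apply/andP; split; lra.
apply: ereal_sup_ubound.
exists (\row_l ((a l).+1%:R * eta - N%:R), \row_l ((a l)%:R * eta - N%:R)).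
  split=> l; rewrite mxE lexx ?andbT/=; rewrite lerD2r ler_wpM2r ?ler_nat//.
    exact: ltW.
  exact: ltW.
congr EFin; rewrite /enorm/=.
under eq_bigr => l _.
  rewrite !mxE (_ : _ - _ = eta); first over.
  by rewrite -natr1; ring.
rewrite sumr_const card_ord -[_ *+ m]mulr_natl sqrtrM ?ler0n// sqrtr_sqr ger0_norm//.
exact: ltW.
Qed.

End covering.

Section upper_bound.
Context (R : realType) (n m : nat) (alpha beta K : R).
Context (E : set 'rV[R]_n) (f : 'rV[R]_n -> 'rV[R]_m) (N : nat).
Hypotheses (n_gt0 : (0 < n)%N) (m_gt0 : (0 < m)%N).
Hypothesis (alpha_gt0 : 0 < alpha).
Hypothesis (beta_lt : beta < alpha).
Hypotheses (E_compact : compact E) (E_neq0 : E !=set0).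
Hypothesis (K_gt0 : 0 < K).
Hypothesis f_incr : forall rho x y l, 0 < rho -> E x -> E y ->
  `|f x ord0 l - f y ord0 l| <= K * Num.max rho (enorm (x - y)) `^ beta.
Hypothesis f_bound : forall x, E x -> `|f x| <= N%:R.

Local Notation s := (m%:R * alpha).
Local Notation cap := (cap E s).
Local Notation q := (Num.sqrt m%:R : R).

Let s_gt0 : 0 < s. Proof. by rewrite mulr_gt0// ltr0n. Qed.
Let q_gt0 : 0 < q. Proof. by rewrite sqrtr_gt0 ltr0n. Qed.

Section scale.
Context (r : R).
Hypotheses (r_gt0 : 0 < r) (r_le1 : r <= 1).

Local Notation eta := (r / q).
Local Notation rho := (r `^ alpha^-1).
Local Notation L := (Num.truncn (N.*2%:R / eta)).+1.

Let eta_gt0 : 0 < eta. Proof. by rewrite divr_gt0. Qed.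
Let rho_gt0 : 0 < rho. Proof. by rewrite powR_gt0. Qed.

Let index : finType := {ffun 'I_m -> 'I_L}.

(** The cells that meet the image of [E]. Their mesh [r / sqrt m] is chosen so
    that the closed cubes have diameter exactly [r]. *)
Definition image_cells : {set index} :=
  [set a : index | `[< exists2 x, E x & cell N eta (f x) = a >]]%SET.

Lemma coverable_image_cells : coverable r (f @` E) #|image_cells|.
Proof.
pose U (c : 'I_#|image_cells|) :=
  grid_cube N eta (fun l => enum_val c l : nat).
exists U; split.
  move=> c; rewrite diameter_grid_cube//; congr EFin.
  by rewrite mulrCA mulfV ?mulr1// gt_eqF.
move=> _ [x Ex <-].
have xa : cell N eta (f x) \in image_cells.
  by rewrite inE; apply/asboolP; exists x.
exists (enum_rank_in xa (cell N eta (f x))) => // l /=.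
rewrite enum_rankK_in//.
have /andP[lo hi] := cell_itv l eta_gt0 (f_bound Ex).
by rewrite lerBlDr lo/= lerBrDr ltW.
Qed.

(** With [t] the maximum of [rho] and the distance from [x] to [y], the left
    side is [r / t `^ alpha], while the cells of [f x] and [f y] differ in
    coordinate [l] by at most a multiple of [t `^ beta / r]. The loss
    [rho `^ (beta - alpha)] comes from the Hoelder exponent being smaller than
    [alpha]. *)
Lemma phi_le_cell_dist x y l : E x -> E y ->
  phi alpha rho (x - y) <=
  (K * q + 2) * rho `^ (beta - alpha) *
  (`|(cell N eta (f x) l)%:R - (cell N eta (f y) l)%:R| + 1)^-1.
Proof.
move=> Ex Ey; set dist := `|_%:R - _|.
have d0 : 0 < dist + 1 by rewrite ltr_wpDl ?normr_ge0.
have rho_le1 : rho <= 1.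
  by apply: powR_le1; rewrite ?invr_ge0// ltW.
rewrite ler_pdivlMr//.
have rhoE : rho `^ alpha = r.
  by rewrite -powRrM mulVf ?gt_eqF// powRr1// ltW.
have := f_incr l rho_gt0 Ex Ey.
rewrite /phi; set t := Num.max _ _ => ft.
have t0 : 0 < t by rewrite lt_max rho_gt0.
have rt : rho <= t by rewrite le_max lexx.
have ta0 : 0 < t `^ alpha by rewrite powR_gt0.
have -> : (rho / t) `^ alpha = r / t `^ alpha.
  by rewrite (powR_div _ (ltW rho_gt0) (ltW t0)) rhoE.
have cell_le : dist * r <= q * K * t `^ beta + r.
  have := cell_coord_dist l eta_gt0 (f_bound Ex) (f_bound Ey).
  rewrite -/dist -(@ler_pM2l _ q)// mulrDr.
  have -> : q * (dist * eta) = dist * r by field; rewrite gt_eqF.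
  have -> : q * eta = r by field; rewrite gt_eqF.
  move=> /le_trans; apply; rewrite lerD2r -mulrA ler_pM2l//.
rewrite mulrAC ler_pdivrMr//.
have tb : t `^ beta = t `^ (beta - alpha) * t `^ alpha.
  by rewrite -powRD ?subrK//; apply/implyP => _; rewrite gt_eqF.
have tba : t `^ (beta - alpha) <= rho `^ (beta - alpha).
  rewrite -[beta - alpha]opprB !powRN lef_pV2 ?posrE ?powR_gt0//.
  by apply: ler_powR2r => //; [rewrite subr_ge0|]; exact: ltW.
have rba1 : 1 <= rho `^ (beta - alpha).
  rewrite -[beta - alpha]opprB powRN -[leLHS]invr1 lef_pV2 ?posrE ?powR_gt0//.
  by apply: powR_le1; rewrite ?subr_ge0// ltW.
have rta : r <= t `^ alpha.
  by rewrite -rhoE; apply: ler_powR2r => //; exact: ltW.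
rewrite mulrDr mulr1 [r * _]mulrC.
apply: (@le_trans _ _ (q * K * t `^ beta + r + r)); first by rewrite lerD2r.
have rr : r <= rho `^ (beta - alpha) * t `^ alpha.
  by apply: (le_trans rta); apply: ler_peMl => //; exact: ltW.
rewrite tb -addrA [leRHS](_ : _ = q * K * rho `^ (beta - alpha) * t `^ alpha +
  2 * (rho `^ (beta - alpha) * t `^ alpha)); last by ring.
apply: lerD; last by rewrite mulr2n mulrDl mul1r lerD.
by rewrite mulrA ler_pM2r// ler_pM2l// mulr_gt0.
Qed.

(** The kernel of exponent [m * alpha] is the product of [m] kernels of
    exponent [alpha], one for each coordinate of the image. *)
Lemma phi_le_cell_prod x y : E x -> E y ->
  phi s rho (x - y) <=
  ((K * q + 2) * rho `^ (beta - alpha)) ^+ m *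
  \prod_l (`|(cell N eta (f x) l)%:R - (cell N eta (f y) l)%:R| + 1)^-1.
Proof.
move=> Ex Ey; rewrite phi_exprE -[in X in X <= _](card_ord m).
rewrite -[in X in _ ^+ X * _](card_ord m) -!prodr_const -big_split/=.
apply: ler_prod => l _; rewrite phi_ge0/=.
exact: phi_le_cell_dist.
Qed.

(** Over all cells of the box the sum of the products factorizes into a product
    over the coordinates of one-dimensional sums. *)
Lemma sum_cell_prod_le (b : index) :
  \sum_(a in image_cells) \prod_l (`|(a l)%:R - (b l)%:R| + 1)^-1
    <= (2 * harmonic_sum R L) ^+ m :> R.
Proof.
apply: (@le_trans _ _
  (\sum_(a : index) \prod_l (`|(a l)%:R - (b l)%:R| + 1)^-1)).
  rewrite [leRHS](bigID (mem image_cells))/= lerDl.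
  by apply: sumr_ge0 => a _; apply: prodr_ge0 => l _; rewrite invr_ge0 addr_ge0.
rewrite -(bigA_distr_bigA (fun l (t : 'I_L) => (`|t%:R - (b l)%:R| + 1)^-1)).
rewrite [leRHS](_ : _ = \prod_(l < m) (2 * harmonic_sum R L)); last first.
  by rewrite prodr_const card_ord.
apply: ler_prod => l _.
rewrite sumr_ge0 => [|t _]; last by rewrite invr_ge0 addr_ge0.
exact: sum_inv_dist_le.
Qed.

(** The uniform measure on one point per cell has energy at least the inverse
    of the capacity, and at most the right factor divided by the number of
    cells. *)
Lemma card_image_cells_le :
  #|image_cells|%:R <= cap rho *
    (((K * q + 2) * rho `^ (beta - alpha)) ^+ m * (2 * harmonic_sum R L) ^+ m).
Proof.
set B := _ ^+ m; set H := _ ^+ m.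
have B0 : 0 <= B.
  by rewrite exprn_ge0// mulr_ge0 ?powR_ge0// addr_ge0// mulr_ge0// ltW.
have [e0 Ee0] := E_neq0.
pose M := #|image_cells|.
have M0 : (0 < M)%N.
  apply/card_gt0P; exists (cell N eta (f e0)).
  by rewrite inE; apply/asboolP; exists e0.
pose I : finType := {a : index | a \in image_cells}.
have /choice[x xP] (i : I) : exists x, E x /\ cell N eta (f x) = val i.
  by have := valP i; rewrite inE => /asboolP[x Ex xi]; exists x.
have MR : 0 < M%:R :> R by rewrite ltr0n.
have wx : weights_in E (fun=> M%:R^-1) x.
  split=> [i||i].
  - by rewrite invr_ge0.
  - rewrite sumr_const card_sig -[LHS]mulr_natl.
    by rewrite divff// gt_eqF.
  - by have [] := xP i.
have energy_le : finite_energy s rho (fun=> M%:R^-1) x <= M%:R^-1 * (B * H).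
  rewrite /finite_energy exchange_big/=.
  apply: (@le_trans _ _ (\sum_(j : I) M%:R^-1 * M%:R^-1 * (B * H))).
    apply: ler_sum => j _; rewrite -mulr_sumr ler_pM2l ?mulr_gt0 ?invr_gt0//.
    apply: (@le_trans _ _ (\sum_(i : I) B *
        \prod_l (`|(val i l)%:R - (val j l)%:R| + 1)^-1)).
      apply: ler_sum => i _; have [Ei ci] := xP i; have [Ej cj] := xP j.
      have := phi_le_cell_prod Ei Ej.
      by rewrite ci cj.
    rewrite -mulr_sumr ler_wpM2l//.
    apply: le_trans (sum_cell_prod_le (val j)).
    by rewrite (big_sub (mem image_cells)).
  rewrite sumr_const card_sig -[leLHS]mulr_natl !mulrA divff ?gt_eqF// mul1r.
  by [].
have := cap_finite_energy_ge1 n_gt0 s_gt0 E_compact E_neq0 rho_gt0 wx.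
have := cap_gt0 n_gt0 s_gt0 E_compact E_neq0 rho_gt0.
move: (cap _) (finite_energy _ _ _ _) energy_le => c e eBH c0 ce.
have : 1 <= c * (M%:R^-1 * (B * H)).
  by apply: (le_trans ce); rewrite ler_pM2l.
by rewrite mulrCA mulrC ler_pdivlMr// mul1r.
Qed.

End scale.

(** The number of cells along an axis is of order [1 / r], and logarithms are
    dominated by powers. *)
Lemma harmonic_sum_cells_le delta : 0 < delta -> exists2 D : R, 0 < D &
  forall r, 0 < r -> r <= 1 ->
  harmonic_sum R (Num.truncn (N.*2%:R / (r / q))).+1 * r `^ delta <= D.
Proof.
move=> delta0; pose c : R := N.*2%:R * q + 1.
have c1 : 1 <= c by rewrite lerDr mulr_ge0// ltW.
have c0 := lt_le_trans ltr01 c1.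
have lnc0 : 0 <= ln c by exact: ln_ge0.
exists (1 + ln c + delta^-1).
  by rewrite addr_gt0 ?invr_gt0// ltr_wpDr.
move=> r r0 r1; have rd0 : 0 < r `^ delta by rewrite powR_gt0.
have rd1 : r `^ delta <= 1 by apply: powR_le1 => //; exact: ltW.
set t := Num.truncn _.
have tc : t.+1%:R <= c / r.
  have : t%:R <= N.*2%:R / (r / q).
    by rewrite truncn_le divr_ge0// divr_ge0// ltW.
  rewrite -natr1 /c mulrDl mul1r invf_div mulrA => /lerD; apply.
  by rewrite invf_ge1.
have lnt : ln t.+1%:R <= ln c - ln r.
  by rewrite -ln_div ?posrE// ler_ln ?posrE// divr_gt0.
have lnr : - ln r * r `^ delta <= delta^-1.
  have : ln (r `^ delta)^-1 <= (r `^ delta)^-1.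
    by apply/ltW/ln_sublinear; rewrite invr_gt0.
  rewrite lnV ?posrE// ln_powR => h.
  rewrite -ler_pdivlMr// -(ler_pM2l delta0) mulrA mulfV ?gt_eqF// mul1r.
  by rewrite mulrN.
have := harmonic_sum_ln R t => ht.
apply: (@le_trans _ _ ((1 + ln c - ln r) * r `^ delta)).
  by rewrite ler_pM2r//; lra.
rewrite mulrDl; apply: lerD => //.
by apply: ler_piMr => //; rewrite addr_ge0.
Qed.

Lemma covering_number_le_cap eps : 0 < eps ->
  (alpha - beta) / alpha * m%:R <= eps / 2 ->
  exists2 L : R, 0 < L & forall r, 0 < r -> r <= 1 ->
    (covering_number r (f @` E))%:R * r `^ eps <= L * cap (r `^ alpha^-1).
Proof.
move=> eps0 beta_eps.
have mR : 0 < m%:R :> R by rewrite ltr0n.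
have delta0 : 0 < eps / 2 / m%:R by rewrite !divr_gt0.
have [D D0 HD] := harmonic_sum_cells_le delta0.
have K2 : 0 < K * q + 2 by rewrite addr_gt0// mulr_gt0.
exists (((K * q + 2) * (2 * D)) ^+ m); first by rewrite exprn_gt0// !mulr_gt0.
move=> r r0 r1.
have [_ cov_le] := covering_numberP (coverable_image_cells r0).
have rho0 : 0 < r `^ alpha^-1 by rewrite powR_gt0.
have cells := card_image_cells_le r0 r1.
have cap0 := cap_gt0 n_gt0 s_gt0 E_compact E_neq0 rho0.
apply: (@le_trans _ _ (#|image_cells r|%:R * r `^ eps)).
  by rewrite ler_wpM2r ?powR_ge0// ler_nat.
apply: (@le_trans _ _ _ _ _ (ler_wpM2r (powR_ge0 _ _) cells)).
have -> : r `^ eps = r `^ (eps / 2) * (r `^ (eps / 2 / m%:R)) ^+ m.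
  rewrite -powR_mulrn ?powR_ge0// -powRrM divfK ?gt_eqF// -powRD.
    by rewrite -splitr.
  by apply/implyP => _; rewrite gt_eqF.
set H := harmonic_sum _ _ in HD *.
have Hr := HD r r0 r1.
have H0 : 0 <= H by apply: sumr_ge0 => j _; rewrite invr_ge0.
have rho_r : (r `^ alpha^-1) `^ (beta - alpha) ^+ m * r `^ (eps / 2) <= 1.
  rewrite -powR_mulrn ?powR_ge0// -!powRrM -powRD; last first.
    by apply/implyP => _; rewrite gt_eqF.
  apply: powR_le1 => //; first exact: ltW.
  have -> : alpha^-1 * ((beta - alpha) * m%:R) = - ((alpha - beta) / alpha * m%:R).
    by field; rewrite gt_eqF.
  by rewrite addrC subr_ge0.
have {Hr} : (H * r `^ (eps / 2 / m%:R)) ^+ m <= D ^+ m.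
  by rewrite lerXn2r// nnegrE ?mulr_ge0 ?powR_ge0// ltW.
rewrite !exprMn => Hr.
set c := cap _; set k := (K * q + 2) ^+ m.
set b := ((_ `^ _) `^ _) ^+ m; set u := r `^ (eps / 2).
set h := H ^+ m; set v := (_ `^ _) ^+ m.
rewrite [leLHS](_ : _ = k * 2 ^+ m * c * ((b * u) * (h * v))); last by ring.
rewrite [leRHS](_ : _ = k * 2 ^+ m * c * (1 * D ^+ m)); last by ring.
apply: ler_wpM2l.
  by rewrite mulr_ge0 ?(ltW cap0)// mulr_ge0 ?exprn_ge0// ltW.
apply: ler_pM => //; by rewrite mulr_ge0 ?powR_ge0// exprn_ge0// powR_ge0.
Qed.

End upper_bound.

(** * Conclusion *)

Lemma profile_ratioE (R : realType) n (E : set 'rV[R]_n) s :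
  (0 < n)%N -> 0 < s -> compact E -> E !=set0 ->
  \forall r \near 0^'+, (lne (capacity r s E) / (- ln r)%:E)%E =
    (ln (cap E s r) / - ln r)%:E.
Proof.
move=> n0 s0 cE E0; near=> r.
have r0 : 0 < r by near: r; exact: nbhs_right_gt.
have r1 : r < 1 by near: r; exact: nbhs_right_lt.
rewrite (capE n0 s0 cE E0 r0).
rewrite lne_EFin; last exact: (cap_gt0 n0 s0 cE E0 r0).
by rewrite inver oppr_eq0 lt_eqF ?EFinM// ln_lt0// r0.
Unshelve. all: by end_near. Qed.

Section sandwich.
Context d (T : measurableType d) (R : realType) (P : probability T R).
Context (n m : nat) (X : T -> 'rV[R]_n -> 'rV[R]_m) (alpha : R).
Context (E : set 'rV[R]_n).
Hypotheses (n_gt0 : (0 < n)%N) (m_gt0 : (0 < m)%N) (alpha_gt0 : 0 < alpha).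
Hypothesis X_fbm : fractional_brownian_motion P X alpha.
Hypotheses (E_compact : compact E) (E_neq0 : E !=set0).

Local Notation s := (m%:R * alpha).
Local Notation cap := (cap E s).
Local Notation cover w r := (covering_number r (X w @` E))%:R.

Lemma ae_image_bounded :
  {ae P, forall w, exists N : nat, forall x, E x -> `|X w x| <= N%:R}.
Proof.
apply: filterS (fbm_continuous X_fbm) => w [Xw_cont _].
have [|N XN] := @compact_norm_le_nat _ _ (X w @` E).
  by apply: continuous_compact => //; exact: continuous_subspaceT.
by exists N => x Ex; apply: XN; exists x.
Qed.

(** The image of [E] is bounded and nonempty, so its covering number is a
    genuine minimum. *)
Lemma covering_number_bounded w (N : nat) r : 0 < r ->
  (forall x, E x -> `|X w x| <= N%:R) ->
  coverable r (X w @` E) (covering_number r (X w @` E)) /\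
  (0 < covering_number r (X w @` E))%N.
Proof.
move=> r0 XN.
have [cov _] := covering_numberP
  (coverable_image_cells m_gt0 XN r0).
split=> //; case: posnP => // N0; move: cov; rewrite N0 => -[U [_ XU]].
have [x Ex] := E_neq0.
by have [[]] := XU _ (imageP (X w) Ex).
Qed.

Lemma ae_cap_le_covering_number eps : 0 < eps ->
  {ae P, forall w, exists2 L, 0 < L &
    \forall r \near 0^'+, cap (r `^ alpha^-1) * r `^ eps <= L * cover w r}.
Proof.
move=> eps0.
have := ae_cap_le_covering n_gt0 m_gt0 alpha_gt0 X_fbm E_compact E_neq0 eps0.
apply: filterS2 ae_image_bounded => w [N XN] [L L0 HL].
exists L => //.
have : \forall r \near 0^'+, (0 : R) < r by exact: nbhs_right_gt.
apply: filterS2 HL => r HL r0; apply: HL.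
have [[U [Ur XU]] _] := covering_number_bounded r0 XN.
by exists U; split=> // i; rewrite Ur.
Qed.

Lemma ae_covering_number_le_cap eps : 0 < eps ->
  {ae P, forall w, exists2 L, 0 < L &
    \forall r \near 0^'+, cover w r * r `^ eps <= L * cap (r `^ alpha^-1)}.
Proof.
move=> eps0; have mR : 0 < m%:R :> R by rewrite ltr0n.
(* [beta] is close enough to [alpha] for the loss in [phi_le_cell_dist],
   raised to the power [m], to cost at most [eps / 2]. *)
pose t := Num.min (2^-1) (eps / 2 / m%:R).
have t0 : 0 < t by rewrite lt_min invr_gt0 ltr0n !divr_gt0.
have t1 : t < 1 by rewrite gt_min invf_lt1// ltr1n.
pose beta := alpha * (1 - t).
have beta0 : 0 < beta by rewrite mulr_gt0// subr_gt0.
have beta_alpha : beta < alpha by rewrite gtr_pMr// gtrBl.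
have beta_eps : (alpha - beta) / alpha * m%:R <= eps / 2.
  have -> : (alpha - beta) / alpha = t by rewrite /beta; field; rewrite gt_eqF.
  by rewrite -ler_pdivlMr// ge_min lexx orbT.
have := ae_increment_bound alpha_gt0 X_fbm
  n_gt0 beta0 beta_alpha E_compact.
apply: filterS2 ae_image_bounded => w [N XN] [K K0 incr].
have [L L0 HL] := covering_number_le_cap
  n_gt0 m_gt0 alpha_gt0 beta_alpha E_compact E_neq0 K0 incr XN eps0 beta_eps.
exists L => //; near=> r; apply: HL; near: r.
  exact: nbhs_right_gt.
exact: nbhs_right_le.
Unshelve. all: by end_near. Qed.

End sandwich.

(** Almost sure statements can be combined for countably many exponents only;
    monotonicity in the exponent recovers the others. *)
Lemma near_powR_weaken (R : realType) (u v : R -> R) (a b : R) :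
  a <= b -> (forall r, 0 <= u r) ->
  (\forall r \near 0^'+, u r * r `^ a <= v r) ->
  \forall r \near 0^'+, u r * r `^ b <= v r.
Proof.
move=> ab u0 uv.
have r0 : \forall r \near 0^'+, (0 : R) < r by exact: nbhs_right_gt.
have r1 : \forall r \near 0^'+, r < (1 : R) by exact: nbhs_right_lt.
apply: filterS3 uv r0 r1 => r uv r0 r1; apply: le_trans uv.
apply: ler_wpM2l => //.
have -> : r `^ b = r `^ a * r `^ (b - a).
  by rewrite -powRD; [rewrite addrC subrK|apply/implyP => _; rewrite gt_eqF].
apply: ler_piMr; first exact: powR_ge0.
by apply: powR_le1; [exact: ltW|exact: ltW|rewrite subr_ge0].
Qed.

Theorem corollary2p11 (R : realType) (d : measure_display)
    (T : measurableType d) (P : probability T R) (n m : nat) (alpha : R)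
    (X : T -> 'rV[R]_n -> 'rV[R]_m) (E : set 'rV[R]_n)
    (n_gt0 : (0 < n)%N) (m_gt0 : (0 < m)%N)
    (alpha_gt0 : 0 < alpha) (alpha_lt1 : alpha < 1)
    (X_fbm : fractional_brownian_motion P X alpha)
    (E_compact : compact E) (E_neq0 : E !=set0) :
  {ae P, forall w,
    lower_box_dim (X w @` E) =
      ((alpha^-1)%:E * lower_box_profile (m%:R * alpha) E)%E /\
    upper_box_dim (X w @` E) =
      ((alpha^-1)%:E * upper_box_profile (m%:R * alpha) E)%E}.
Proof.
set s := m%:R * alpha.
have s_gt0 : 0 < s by rewrite mulr_gt0// ltr0n.
pose c := cap E s.
have c_gt0 r : 0 < r -> 0 < c r by exact: cap_gt0.
pose a := alpha^-1; have a_gt0 : 0 < a by rewrite invr_gt0.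
pose e (k : nat) : R := k.+1%:R^-1.
have e_gt0 k : 0 < e k by rewrite invr_gt0.
have le_e eps : 0 < eps -> exists k, e k <= eps.
  move=> eps0; exists (Num.truncn eps^-1); rewrite invf_ple ?posrE//.
  exact/ltW/truncnS_gt.
have := ae_foralln (fun k => ae_covering_number_le_cap
  n_gt0 m_gt0 alpha_gt0 X_fbm E_compact E_neq0 (e_gt0 k)).
have := ae_foralln (fun k => ae_cap_le_covering_number
  n_gt0 m_gt0 alpha_gt0 X_fbm E_compact E_neq0 (e_gt0 k)).
have := ae_image_bounded X_fbm E_compact.
apply: filterS3 => w [N XN] cap_le cov_le.
pose x (r : R) : R := (covering_number r (X w @` E))%:R.
have x_gt0 : \forall r \near 0^'+, 0 < x r.
  near=> r; rewrite ltr0n.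
  have r0 : 0 < r by near: r; exact: nbhs_right_gt.
  by have [] := covering_number_bounded m_gt0 E_neq0 r0 XN.
have cx eps : 0 < eps -> exists2 K : R, 0 < K &
    \forall r \near 0^'+, c (r `^ a) * r `^ eps <= K * x r.
  move=> /le_e[k ke]; have [L L0 HL] := cap_le k; exists L => //.
  near=> r.
  have r0 : 0 < r by near: r; exact: nbhs_right_gt.
  rewrite -[c _]gtr0_norm ?c_gt0 ?powR_gt0//; near: r.
  apply: (near_powR_weaken (u := fun r => `|c (r `^ a)|) ke) => //.
  near=> r; have r0 : 0 < r by near: r; exact: nbhs_right_gt.
  by rewrite gtr0_norm ?c_gt0 ?powR_gt0//; near: r.
have xc eps : 0 < eps -> exists2 K : R, 0 < K &
    \forall r \near 0^'+, x r * r `^ eps <= K * c (r `^ a).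
  move=> /le_e[k ke]; have [L L0 HL] := cov_le k; exists L => //.
  by apply: (near_powR_weaken ke) => // r; rewrite ler0n.
have ratio := ln_ratio_near a_gt0 c_gt0 x_gt0 cx xc.
have profileE := profile_ratioE n_gt0 s_gt0 E_compact E_neq0.
rewrite /lower_box_profile /upper_box_profile.
rewrite (near_eq_limf_einf _ profileE).
rewrite (near_eq_limf_esup _ profileE).
split.
  exact: (limf_einf_powR (u := fun r => ln (x r) / - ln r)
    (v := fun r => ln (c r) / - ln r)).
exact: (limf_esup_powR (u := fun r => ln (x r) / - ln r)
  (v := fun r => ln (c r) / - ln r)).
Unshelve. all: by end_near. Qed.
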